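(* Given a collection $\mathcal{U}$ of $n$ circular arcs, one can compute in time $O(n\log n)$ a subcollection $\mathcal{U}'\subseteq\mathcal{U}$ such that $\mathcal{N}(\mathcal{U}')\cong\mathcal{N}(|\mathcal{U}'|,k)$ for some $k$ and the inclusion $\mathcal{N}(\mathcal{U}')\hookrightarrow\mathcal{N}(\mathcal{U})$ is a homotopy equivalence.
   Context: $S^1=\mathbb{R}/\mathbb{Z}$. For real $x\le y$, the closed circular arc $[x,y]_{S^1}$ is the image of $[x,y]$ under $\mathbb{R}\to\mathbb{R}/\mathbb{Z}$; open and half-open arcs are obtained by removing endpoints. Arcs are nonempty, $n\ge1$, and each arc is given as input by its endpoints. Running time counts elementary operations, including comparisons of endpoints in the cyclic order, each at unit cost. For a collection $\mathcal{U}=\{U_i\}_{i\in I}$ of nonempty sets, the nerve complex $\mathcal{N}(\mathcal{U})$ has vertex set $I$, and $[i_0,\dots,i_m]$ is a simplex iff $U_{i_0}\cap\dots\cap U_{i_m}\ne\emptyset$. For integers $m\ge1$ and $i\le j$, $[i,j]_m$ is the image of $\{i,\dots,j\}$ under $\mathbb{Z}\to\mathbb{Z}/m$; for $m\ge 1$, $k\ge0$, $\mathcal{N}(m,k)$ is the simplicial complex with vertex set $\{0,\dots,m-1\}$ (identified with $\mathbb{Z}/m$) whose maximal simplices are the sets $[i,i+k]_m$, $i=0,\dots,m-1$. The symbol $\cong$ denotes isomorphism of simplicial complexes. *)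

(* Defs.v *)
From HB Require Import structures.
From mathcomp Require Export all_boot all_order all_algebra generic_quotient.
From mathcomp Require Export all_classical all_reals all_analysis.
Export Order.TTheory GRing.Theory Num.Theory numFieldNormedType.Exports.

#[export] Set Implicit Arguments.
#[export] Unset Strict Implicit.
#[export] Unset Printing Implicit Defensive.

Global Open Scope classical_set_scope.
Global Open Scope ring_scope.
Global Open Scope quotient_scope.

Section Circle.
Variable R : realType.

Definition eq_mod1 (x y : R) : bool := x - y \is a Num.int.

Lemma eq_mod1_refl : reflexive eq_mod1.
Proof. by move=> x; rewrite /eq_mod1 subrr rpred0. Qed.

Lemma eq_mod1_sym : symmetric eq_mod1.
Proof. by move=> x y; rewrite /eq_mod1 -opprB rpredN. Qed.

Lemma eq_mod1_trans : transitive eq_mod1.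
Proof.
move=> y x z xy yz.
by rewrite /eq_mod1 -(subrK y x) -addrA rpredD.
Qed.

Canonical eq_mod1_equiv := EquivRel eq_mod1 eq_mod1_refl eq_mod1_sym eq_mod1_trans.

Definition circle := {eq_quot eq_mod1}.

Definition frac_part (t : R) : R := t - (Num.floor t)%:~R.

(* Going around counterclockwise from [p], one meets [q] no later than [r].
   This is the non-strict cyclic order; [cyc_le p q p] says [q = p]. *)
Definition cyc_le (p q r : circle) : bool :=
  frac_part (repr q - repr p) <= frac_part (repr r - repr p).

(* The arc is the image in R/Z of the real interval with endpoints [lo], [hi];
   [lo_in] and [hi_in] tell which of the two endpoints belong to the interval.
   Lengths [hi - lo] of one turn or more are allowed. *)
Record arc := Arc {
  lo : R; hi : R; lo_in : bool; hi_in : bool; _ : lo <= hi }.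

Definition arc_itv (a : arc) : interval R :=
  Interval (BSide (lo_in a) (lo a)) (BSide (~~ hi_in a) (hi a)).

Definition arc_set (a : arc) : set circle :=
  (fun t : R => \pi_circle t) @` [set` arc_itv a].

Inductive side := Lo | Hi.

Definition endpoint (s : side) (a : arc) : circle :=
  \pi_circle (match s with Lo => lo a | Hi => hi a end).

Definition has_endpoint (s : side) (a : arc) : bool :=
  match s with Lo => lo_in a | Hi => hi_in a end.

End Circle.

(* Finite abstract simplicial complexes, without the empty simplex. The vertices
   may form a proper subset of the ambient type [V]. *)
Record complex (V : finType) := Complex {
  simplex :> {set V} -> Prop;
  simplex_neq0 : forall s, simplex s -> s != finset.set0;
  simplex_sub : forall s t : {set V},
    simplex s -> t \subset s -> t != finset.set0 -> simplex t }.

Definition vertex (V : finType) (K : complex V) (v : V) : Prop := K [set v]%SET.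

Definition complex_iso (V W : finType) (K : complex V) (L : complex W) : Prop :=
  exists f : V -> W,
    [/\ forall v, vertex K v -> vertex L (f v),
        forall u v, vertex K u -> vertex K v -> f u = f v -> u = v,
        forall w, vertex L w -> exists2 v, vertex K v & f v = w &
        forall s : {set V}, (forall v, v \in s -> vertex K v) ->
          (K s <-> L [set f v | v in s]%SET)].

Section Nerve.
Variables (I : finType) (T : Type) (S : {set I}) (U : I -> set T).

Definition nerve_simplex (s : {set I}) : Prop :=
  [/\ s != finset.set0, s \subset S & exists x, forall i, i \in s -> U i x].

Lemma nerve_simplex_neq0 s : nerve_simplex s -> s != finset.set0.
Proof. by case. Qed.

Lemma nerve_simplex_sub (s t : {set I}) :
  nerve_simplex s -> t \subset s -> t != finset.set0 -> nerve_simplex t.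
Proof.
move=> [_ sS [x xU]] ts t0; split=> //; first exact: fintype.subset_trans sS.
by exists x => i it; apply: xU; apply: (fintype.subsetP ts).
Qed.

(* The nerve of the subfamily [U i], [i \in S]. *)
Definition nerve : complex I := Complex nerve_simplex_neq0 nerve_simplex_sub.

End Nerve.

Section CyclicComplex.
Variables m k : nat.

(* [i, i + k]_m, with Z/m identified with {0, ..., m - 1} *)
Definition cyclic_itv (i : 'I_m) : {set 'I_m} :=
  [set j : 'I_m | [exists d : 'I_k.+1, (i + d) %% m == j]]%N%SET.

Definition cyclic_simplex (s : {set 'I_m}) : Prop :=
  s != finset.set0 /\ exists i, s \subset cyclic_itv i.

Lemma cyclic_simplex_neq0 s : cyclic_simplex s -> s != finset.set0.
Proof. by case. Qed.

Lemma cyclic_simplex_sub (s t : {set 'I_m}) :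
  cyclic_simplex s -> t \subset s -> t != finset.set0 -> cyclic_simplex t.
Proof.
move=> [_ [i si]] ts t0; split=> //.
by exists i; apply: fintype.subset_trans si.
Qed.

Definition cyclic_complex : complex 'I_m :=
  Complex cyclic_simplex_neq0 cyclic_simplex_sub.

End CyclicComplex.

(* Points of the geometric realization are given by barycentric coordinates, so
   that the realization of a subcomplex is a subset of that of the complex. *)
Definition realization (R : realType) n (K : complex 'I_n) : set 'rV[R]_n :=
  [set x | [/\ forall i, 0 <= x ord0 i, \sum_i x ord0 i = 1 &
               K [set i | x ord0 i != 0]%SET]].

Section Homotopy.
Variables (R : realType) (X Y : topologicalType).

Definition continuous_map (A : set X) (B : set Y) (f : X -> Y) : Prop :=
  {within A, continuous f} /\ (forall x, A x -> B (f x)).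

Definition homotopic (A : set X) (B : set Y) (f g : X -> Y) : Prop :=
  exists H : R * X -> Y,
    [/\ {within `[0, 1]%classic `*` A, continuous H},
        forall t x, 0 <= t <= 1 -> A x -> B (H (t, x)),
        forall x, A x -> H (0, x) = f x &
        forall x, A x -> H (1, x) = g x].

End Homotopy.

Definition homotopy_equivalence (R : realType) (X Y : topologicalType)
    (A : set X) (B : set Y) (f : X -> Y) : Prop :=
  continuous_map A B f /\
  exists g : Y -> X,
    [/\ continuous_map B A g,
        homotopic R A A (g \o f) idfun &
        homotopic R B B (f \o g) idfun].

Definition inclusion_homotopy_equivalence (R : realType) n
    (K L : complex 'I_n) : Prop :=
  homotopy_equivalence R (@realization R n K) (@realization R n L) idfun.

(* Model of computation: a random access machine over natural numbers, with
   structured control flow, finitely many variables and arrays, and whose only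
   arithmetic is addition and truncated subtraction. The input arcs can be
   accessed only through the tests [CycLe], [HasEnd], [LtTurn], [LeTurn]. *)

Inductive expr :=
| Cst of nat
| Var of nat
| Get of nat & expr
| Plus of expr & expr
| Minus of expr & expr.

(* [LtTurn e] and [LeTurn e] compare the real endpoint [hi] of arc number [e]
   with [lo + 1]; the images of [lo] and [hi] in the circle do not determine the
   arc, e.g. when they coincide. *)
Inductive test :=
| Le of expr & expr
| CycLe of side & expr & side & expr & side & expr
| HasEnd of side & expr
| LtTurn of expr
| LeTurn of expr
| Not of test
| And of test & test.

Inductive prog :=
| Skip
| Assign of nat & expr
| Put of nat & expr & expr
| Seq of prog & prog
| If of test & prog & prog
| While of test & prog.

Record state := State { var : nat -> nat; arr : nat -> nat -> nat }.

Definition upd (T : Type) (f : nat -> T) (i : nat) (v : T) : nat -> T :=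
  fun j => if j == i then v else f j.

Fixpoint eval_expr (st : state) (e : expr) : nat :=
  match e with
  | Cst c => c
  | Var x => var st x
  | Get a e => arr st a (eval_expr st e)
  | Plus e1 e2 => (eval_expr st e1 + eval_expr st e2)%N
  | Minus e1 e2 => (eval_expr st e1 - eval_expr st e2)%N
  end.

Fixpoint expr_cost (e : expr) : nat :=
  match e with
  | Cst _ | Var _ => 1
  | Get _ e => (expr_cost e).+1
  | Plus e1 e2 | Minus e1 e2 => (expr_cost e1 + expr_cost e2).+1
  end.

Section Semantics.
Variables (R : realType) (n : nat) (U : 'I_n -> arc R).

Definition input (st : state) (e : expr) : option (arc R) :=
  omap U (insub (eval_expr st e)).

(* Tests on arc numbers out of range are false. *)
Fixpoint eval_test (st : state) (b : test) : bool :=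
  match b with
  | Le e1 e2 => (eval_expr st e1 <= eval_expr st e2)%N
  | CycLe s1 e1 s2 e2 s3 e3 =>
      match input st e1, input st e2, input st e3 with
      | Some a1, Some a2, Some a3 =>
          cyc_le (endpoint s1 a1) (endpoint s2 a2) (endpoint s3 a3)
      | _, _, _ => false
      end
  | HasEnd s e => oapp (has_endpoint s) false (input st e)
  | LtTurn e => oapp (fun a => hi a < lo a + 1) false (input st e)
  | LeTurn e => oapp (fun a => hi a <= lo a + 1) false (input st e)
  | Not b => ~~ eval_test st b
  | And b1 b2 => eval_test st b1 && eval_test st b2
  end.

Fixpoint test_cost (b : test) : nat :=
  match b with
  | Le e1 e2 => (expr_cost e1 + expr_cost e2).+1
  | CycLe _ e1 _ e2 _ e3 => (expr_cost e1 + expr_cost e2 + expr_cost e3).+1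
  | HasEnd _ e | LtTurn e | LeTurn e => (expr_cost e).+1
  | Not b => (test_cost b).+1
  | And b1 b2 => (test_cost b1 + test_cost b2).+1
  end.

(* [exec p st t st']: started in state [st], the program [p] halts in state
   [st'] after [t] elementary operations. *)
Inductive exec : prog -> state -> nat -> state -> Prop :=
| exec_skip st : exec Skip st 1 st
| exec_assign x e st :
    exec (Assign x e) st (expr_cost e).+1
      (State (upd (var st) x (eval_expr st e)) (arr st))
| exec_put a e1 e2 st :
    exec (Put a e1 e2) st (expr_cost e1 + expr_cost e2).+1
      (State (var st)
         (upd (arr st) a (upd (arr st a) (eval_expr st e1) (eval_expr st e2))))
| exec_seq p1 p2 st t1 st1 t2 st2 :
    exec p1 st t1 st1 -> exec p2 st1 t2 st2 ->
    exec (Seq p1 p2) st (t1 + t2) st2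
| exec_if b p1 p2 st t st' :
    exec (if eval_test st b then p1 else p2) st t st' ->
    exec (If b p1 p2) st (test_cost b + t).+1 st'
| exec_while_true b p st t1 st1 t2 st2 :
    eval_test st b -> exec p st t1 st1 -> exec (While b p) st1 t2 st2 ->
    exec (While b p) st (test_cost b + t1 + t2).+1 st2
| exec_while_false b p st :
    ~~ eval_test st b -> exec (While b p) st (test_cost b).+1 st.

(* Variable 0 initially holds the number of arcs; everything else is 0. *)
Definition init_state : state :=
  State (fun x => if x == 0%N then n else 0%N) (fun _ _ => 0%N).

(* The output is the set of indices of the nonzero entries of array 0. *)
Definition computes_in (p : prog) (t : nat) (S : {set 'I_n}) : Prop :=
  exists st, exec p init_state t st /\ S = [set i : 'I_n | arr st 0%N i != 0%N]%SET.

End Semantics.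

(* Main.v *)
(* If some arc is the whole circle, it alone is a valid answer. Otherwise the nerve
   depends only on the cyclic order of the 2n endpoints, and the algorithm iterates
   the greedy map h, which sends an arc i to the arc that reaches furthest among
   those that begin before i ends.

   Let V be a set of arcs with h(V) included in V. An arc j of V is dominated in the
   nerve of V by h(i), where i is the arc of V that is the first to end after the
   beginning of j. Hence h(V) gives a deformation retract of the nerve of V, and so
   does the set P of periodic points of h, the image of h^m for every m >= n. No arc
   of P contains another, and h permutes P and preserves the cyclic order of the
   ends, so it is a rotation of P by some k; arc j of P meets the beginnings of
   exactly those arcs of P that are at most k places after j. This identifies the
   nerve of P with N(|P|, k).

   Merge sort gives the cyclic order of the endpoints, a scan of two turns around
   the circle gives h, and squaring the map about log n times gives h^m. *)
Require Import Defs.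
From mathcomp Require Import zify ring lra.

(** * Cyclic distance and the greedy map *)

Section CyclicDistance.
Local Open Scope set_scope.
Local Open Scope nat_scope.

(** Open, closed and coinciding endpoints are the obstacle: they would split every geometric step
    into cases. They disappear once the 2n endpoints are turned into cuts of the circle and ranked
    without ties among 0, ..., 2n - 1. A point is then replaced by a gap between cyclically
    consecutive ranks, and a family of arcs has a common point iff it has a common gap. What remains
    concerns distances around a cycle of length N = 2n, where greediness is a linear inequality and
    each case analysis is linear arithmetic. The retraction must send a simplex to a simplex that
    spans one together with the original. Domination settles this for one vertex only, and it may
    move the common gap; hence vertices are treated one after another. *)

Definition cdist (N p q : nat) : nat := if p <= q then q - p else q + N - p.

Lemma cdistP N p q :
  p < N -> q < N ->
  (p <= q /\ cdist N p q + p = q) \/ (q < p /\ cdist N p q + p = q + N).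
Proof. by move=> pN qN; rewrite /cdist; have [pq|qp] := leqP p q; [left|right]; lia. Qed.

End CyclicDistance.

Ltac cdist_lia :=
  repeat match goal with
  | |- context[cdist ?N ?p ?q] =>
    let H := fresh in assert (H := @cdistP N p q); move: (cdist N p q) H => ? ? end;
  intros;
  repeat match goal with H : is_true (?p < ?N) -> _, H' : is_true (?p < ?N) |- _ => specialize (H H') end;
  lia.

Lemma cdist_between N x y z : (x < N)%N -> (y < N)%N -> (z < N)%N ->
  (cdist N x y <= cdist N x z)%N -> (cdist N y z + cdist N x y = cdist N x z)%N.
Proof. by cdist_lia. Qed.

(* Arc [j] begins at position [l j] and ends at position [r j] of a cycle of length
   [N]. Without the truncated subtraction, [h_greedy] says that the distance by which
   [j] reaches beyond the end of [i], [cdist (l j) (r j) - cdist (l j) (r i)], is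
   maximal at [j = h i]. *)
Section Greedy.
Local Open Scope set_scope.
Local Open Scope nat_scope.
Variables (I : finType) (N : nat) (l r : I -> nat) (h : I -> I).
Hypothesis lN : forall i, l i < N.
Hypothesis rN : forall i, r i < N.
Hypothesis r_inj : injective r.
Hypothesis lr : forall i j, l i != r j.

(** Position [p] stands for the gap that follows the endpoint at [p]: hence [l j] is counted and
    [r j] is not. *)
Definition covers (j : I) (p : nat) : bool := cdist N (l j) p < cdist N (l j) (r j).

Hypothesis h_greedy : forall i j,
  cdist N (l j) (r j) + cdist N (l (h i)) (r i)
    <= cdist N (l (h i)) (r (h i)) + cdist N (l j) (r i).

(** Seen from the beginning of [j], no arc of [V] ends before [r i]. So a common gap before [r i]
    can be pushed forward up to it without leaving an arc of [s], and [h i] contains the gap just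
    before [r i]. A common gap after [r i] lies in [j], and [h i] reaches beyond [r i] at least as
    far as [j] does. *)
Lemma greedy_dominates (V : {set I}) (i j : I) (s : {set I}) p :
  (forall i', i' \in V -> cdist N (l j) (r i) <= cdist N (l j) (r i')) ->
  s \subset V -> j \in s -> p < N -> (forall k, k \in s -> covers k p) ->
  exists p', [/\ p' < N, forall k, k \in s -> covers k p' & covers (h i) p'].
Proof.
move=> imin sV js pN cov.
have [p_before|p_after] := ltnP (cdist N (l j) p) (cdist N (l j) (r i)).
  (* The last gap before the end of [i], that is [r i - 1] modulo [N]. *)
  exists (if r i is q.+1 then q else N.-1); split.
  - by move: (rN i); case: (r i); lia.
  - move=> k ks.
    have := imin _ (fintype.subsetP sV _ ks).
    have := cov _ ks; rewrite /covers.
    move: (lN j) (lN k) (rN k) (rN i) (lr j i) (lr k k) (lr k i) (lr j k) p_before.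
    by clear -pN; case: (r i) => [|q]; cdist_lia.
  - have := h_greedy i i; rewrite /covers.
    move: (lN (h i)) (rN (h i)) (rN i) (lN i) (lr (h i) i) (lr (h i) (h i)) (lr i i).
    by move: (h i) => i'; clear; case: (r i) => [|q]; cdist_lia.
exists p; split=> //.
have := h_greedy i j; have := cov _ js; rewrite /covers.
move: (lN (h i)) (rN (h i)) (rN i) (lN j) (rN j) (lr (h i) i) (lr (h i) (h i)) (lr j i) p_after.
by move: (h i) => i'; clear -pN; cdist_lia.
Qed.

Variable P : {set I}.
Hypothesis hP : [set h i | i in P] = P.

(** As [i] is some [h i'], an arc beginning before it and ending after it would have been a better
    choice at the end of [i']. *)
Lemma periodic_noncontained i j :
  i \in P -> j \in P -> i != j -> covers j (l i) -> cdist N (l i) (r j) < cdist N (l i) (r i).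
Proof.
rewrite -{1}hP => /imsetP[i' i'P ->] jP ij; rewrite /covers.
have rij : r (h i') != r j by rewrite (inj_eq r_inj).
have := h_greedy i' j.
move: (lN (h i')) (rN (h i')) (rN i') (lN j) (rN j) (lr (h i') i')
  (lr (h i') (h i')) (lr j i') (lr j (h i')) (lr (h i') j) (lr j j) rij.
by move: (h i') => i''; clear; cdist_lia.
Qed.

(** From left to right, greediness bounds how far [i] reaches beyond the end of [j]. Conversely, an
    arc of [P] that ends between [r j] and [r (h j)] without beginning in [j] would lie inside [h j]
    or contain [j]. *)
Lemma periodic_covers i j : i \in P -> j \in P ->
  covers j (l i) = (cdist N (r j) (r i) <= cdist N (r j) (r (h j))).
Proof.
move=> iP jP.
have hjP : h j \in P by rewrite -hP imset_f.
have [->|ij] := eqVneq i j.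
  have := lr j j; have := lN j; have := rN j; clear; rewrite /covers; cdist_lia.
have rij : r i != r j by rewrite (inj_eq r_inj).
have ncij := periodic_noncontained iP jP ij.
have ji : j != i by rewrite eq_sym.
have ncji := periodic_noncontained jP iP ji.
have hjj : cdist N (l (h j)) (r j) <= cdist N (l (h j)) (r (h j)).
  by have := h_greedy j j; lia.
have rhj := cdist_between (lN (h j)) (rN j) (rN (h j)) hjj.
apply/idP/idP => cov.
  have := cdist_between (lN i) (rN j) (rN i) (ltnW (ncij cov)).
  by have := h_greedy j i; lia.
have nchj : i != h j -> covers (h j) (l i) -> cdist N (l i) (r (h j)) < cdist N (l i) (r i).
  exact: periodic_noncontained.
have li_rj : cdist N (l i) (r j) <= cdist N (l i) (r i).
  have [->//|ihj] := eqVneq i (h j).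
  rewrite leqNgt; apply/negP => lirj.
  have cov_hj : covers (h j) (l i).
    move: (lN (h j)) (rN (h j)) (lN i) (rN i) (rN j) (lr i j) (lr i (h j)) cov hjj lirj.
    by rewrite /covers; move: (h j) => j'; clear; cdist_lia.
  move: (nchj ihj cov_hj) cov lirj (lN i) (rN i) (rN j) (rN (h j)).
  by clear; cdist_lia.
apply/negPn/negP => ncov.
have cov_ji : covers i (l j).
  move: ncov li_rj (lN i) (lN j) (rN i) (rN j) rij (lr i j).
  by rewrite /covers; clear; cdist_lia.
move: (ncji cov_ji) ncov li_rj (lr i j) (lN i) (lN j) (rN i) (rN j) rij.
by rewrite /covers; clear; cdist_lia.
Qed.


Definition rank_in (i : I) : nat := #|[set j in P | r j < r i]|.
Let m := #|P|.

Lemma rank_in_lt i : i \in P -> rank_in i < m.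
Proof.
move=> iP; apply: proper_card; apply/fintype.properP; split.
  by apply/fintype.subsetP => j; rewrite inE => /andP[].
by exists i => //; rewrite inE ltnn andbF.
Qed.

Lemma rank_in_mono i j : i \in P -> j \in P -> (rank_in i < rank_in j) = (r i < r j).
Proof.
move=> iP jP; have [rij|rji] := ltnP (r i) (r j); last first.
  apply: negbTE; rewrite -leqNgt; apply: subset_leq_card.
  by apply/fintype.subsetP => k; rewrite !inE => /andP[-> /=]; lia.
apply: proper_card; apply/fintype.properP; split.
  by apply/fintype.subsetP => k; rewrite !inE => /andP[-> /=]; lia.
by exists i; rewrite inE iP ?ltnn.
Qed.

Lemma rank_in_inj i j : i \in P -> j \in P -> rank_in i = rank_in j -> i = j.
Proof.
move=> iP jP E; apply: r_inj.
by have := rank_in_mono iP jP; have := rank_in_mono jP iP; lia.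
Qed.

Lemma rank_in_surj x : x < m -> exists2 i, i \in P & rank_in i = x.
Proof.
move=> xm; pose f i : 'I_m.+1 := inord (rank_in i).
have fE i : i \in P -> f i = rank_in i :> nat.
  by move=> iP; rewrite inordK // ltnS ltnW // rank_in_lt.
have f_inj : {in P &, injective f}.
  by move=> i j iP jP /(congr1 val); rewrite /= !fE //; apply: rank_in_inj.
pose D := [set y : 'I_m.+1 | y < m].
have cD : #|D| = m.
  have -> : D = ~: [set ord_max].
    by apply/setP => y; rewrite !inE -val_eqE /=; have := ltn_ord y; lia.
  by rewrite cardsC1 card_ord.
have fD : f @: P = D.
  apply/eqP; rewrite eqEcard card_in_imset // cD leqnn andbT.
  by apply/fintype.subsetP => _ /imsetP[i iP ->]; rewrite inE fE // rank_in_lt.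
have : (inord x : 'I_m.+1) \in D by rewrite inE inordK // ltnS ltnW.
rewrite -fD => /imsetP[i iP /(congr1 val) /=]; rewrite fE // inordK ?ltnS 1?ltnW // => ->.
by exists i.
Qed.

(** An increasing relabelling of the ends keeps their cyclic order, so distances compare alike in
    ranks although their values change. *)
Lemma rank_in_cdist i j k : i \in P -> j \in P -> k \in P ->
  (cdist m (rank_in i) (rank_in j) <= cdist m (rank_in i) (rank_in k))
  = (cdist N (r i) (r j) <= cdist N (r i) (r k)).
Proof.
move=> iP jP kP.
move: (rank_in_lt iP) (rank_in_lt jP) (rank_in_lt kP) (rN i) (rN j) (rN k)
  (rank_in_mono iP jP) (rank_in_mono iP kP) (rank_in_mono kP jP)
  (rank_in_mono jP iP) (rank_in_mono kP iP) (rank_in_mono jP kP).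
by move: (rank_in i) (rank_in j) (rank_in k) => x y z; clear; cdist_lia.
Qed.

Let shift j := cdist m (rank_in j) (rank_in (h j)).

(** Here [j] is the cyclic successor of [i]. If its shift were smaller, [h j] would end strictly
    before [h i], as seen from the end of [i]; since [h i] begins before that end, it would have
    been a better choice for [j]. *)
Lemma shift_le i j : i \in P -> j \in P ->
  rank_in j = (if (rank_in i).+1 == m then 0 else (rank_in i).+1) -> shift i <= shift j.
Proof.
move=> iP jP ji'.
have ji : (rank_in i).+1 = m /\ rank_in j = 0 \/ rank_in j = (rank_in i).+1.
  by move: ji'; have [] := eqVneq (rank_in i).+1 m; [left|right].
have inP k : k \in P -> h k \in P by move=> kP; rewrite -hP imset_f.
have [E|ij] := eqVneq i j; first by rewrite E.
have h_inj : h i != h j.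
  apply: contra_neq ij => E.
  have : {in P &, injective h} by apply/imset_injP; rewrite hP.
  by apply.
have hij : rank_in (h i) != rank_in (h j).
  by apply: contra_neq h_inj => E; apply: rank_in_inj => //; apply: inP.
rewrite leqNgt; apply/negP => lt_shift.
have rij : cdist N (r i) (r j) <= cdist N (r i) (r (h j)).
  rewrite -rank_in_cdist ?inP //; move: lt_shift ji (rank_in_lt iP) (rank_in_lt jP).
  move: (rank_in_lt (inP _ iP)) (rank_in_lt (inP _ jP)) hij.
  have : rank_in i != rank_in j by apply: contra_neq ij => E; apply: rank_in_inj.
  by rewrite /shift; clear; cdist_lia.
have rhij : cdist N (r i) (r (h j)) < cdist N (r i) (r (h i)).
  rewrite ltnNge -rank_in_cdist ?inP // -ltnNge.
  move: lt_shift ji (rank_in_lt iP) (rank_in_lt jP).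
  move: (rank_in_lt (inP _ iP)) (rank_in_lt (inP _ jP)) hij.
  by rewrite /shift; clear; cdist_lia.
have hkk k : cdist N (l (h k)) (r k) <= cdist N (l (h k)) (r (h k)).
  by have := h_greedy k k; lia.
have Ei := cdist_between (lN (h i)) (rN i) (rN (h i)) (hkk i).
have Ej := cdist_between (lN (h j)) (rN j) (rN (h j)) (hkk j).
have E := cdist_between (rN i) (rN j) (rN (h j)) rij.
have rij' : cdist N (r i) (r j) <= cdist N (r i) (r (h i)) by lia.
have E' : cdist N (l (h i)) (r i) + cdist N (r i) (r j) = cdist N (l (h i)) (r j).
  move: rij' (hkk i) (lN (h i)) (rN i) (rN j) (rN (h i)).
  by move: (h i) => i'; clear; cdist_lia.
by have := h_greedy j (h i); lia.
Qed.

(** The shift cannot decrease from one place to the next, and the places form a cycle, so it is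
    constant; this constant is [k]. *)
Lemma periodic_covers_rank : 0 < m -> exists2 k, k < m & forall i j, i \in P -> j \in P ->
  covers j (l i) = (cdist m (rank_in j) (rank_in i) <= k).
Proof.
move=> m_gt0.
have inP k : k \in P -> h k \in P by move=> kP; rewrite -hP imset_f.
have [i0 i0P ri0] := rank_in_surj m_gt0.
have ge_shift0 x i : i \in P -> rank_in i = x -> shift i0 <= shift i.
  elim: x i => [|x IHx] i iP rix.
    by rewrite (rank_in_inj iP i0P) // rix.
  have xm : x < m by have := rank_in_lt iP; lia.
  have [j jP rj] := rank_in_surj xm.
  apply: leq_trans (IHx _ jP rj) _; apply: shift_le => //.
  by rewrite rj rix; case: eqP => //; have := rank_in_lt iP; lia.
have le_shift0 y i : i \in P -> rank_in i + y.+1 = m -> shift i <= shift i0.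
  elim: y i => [|y IHy] i iP rix.
    by apply: shift_le => //; rewrite ri0 -rix addn1 eqxx.
  have xm : (rank_in i).+1 < m by lia.
  have [j jP rj] := rank_in_surj xm.
  apply: leq_trans (IHy _ jP _); last by lia.
  by apply: shift_le => //; case: eqP => //; lia.
exists (shift i0).
  have := rank_in_lt i0P; have := rank_in_lt (inP _ i0P).
  by rewrite /shift; clear; cdist_lia.
move=> i j iP jP; rewrite periodic_covers // -rank_in_cdist ?inP //.
rewrite -[cdist _ _ (rank_in (h j))]/(shift j).
suff -> : shift j = shift i0 by [].
have rj := rank_in_lt jP.
apply/eqP; rewrite eqn_leq (ge_shift0 _ j jP erefl) andbT.
by apply: (le_shift0 (m - (rank_in j).+1)) => //; lia.
Qed.

(* Of the arcs through a common gap, take the one that begins last before it. *)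
Lemma covers_last_start (s : {set I}) p :
  p < N -> s != finset.set0 -> (forall j, j \in s -> covers j p) ->
  exists2 i, i \in s & forall j, j \in s -> covers j (l i).
Proof.
move=> pN /finset.set0Pn[i0 i0s] cov.
have [i is_ imin] := @arg_minnP _ i0 (mem s) (fun i => cdist N (l i) p) i0s.
exists i => // j js.
move: (imin _ js) (cov _ js) (cov _ is_) pN (lN i) (lN j) (rN j).
by rewrite /covers; clear; cdist_lia.
Qed.

End Greedy.

(** * Iterated images of a self-map of a finite set *)

Section IteratedImage.
Local Open Scope set_scope.
Local Open Scope nat_scope.
Variables (I : finType) (h : I -> I).

Definition iter_image k : {set I} := iter k (fun A : {set I} => h @: A) [set: I].

Lemma mem_iter_image k i : reflect (exists j, i = iter k h j) (i \in iter_image k).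
Proof.
apply: (iffP idP) => [|[j ->]].
  elim: k i => [|k IHk] i /=; first by exists i.
  by move=> /imsetP[i' /IHk[j ->] ->]; exists j.
by elim: k => [|k IHk] /=; rewrite ?inE ?imset_f.
Qed.

Lemma iter_image_sub k : h @: iter_image k \subset iter_image k.
Proof. by elim: k => [|k IHk]; [exact: finset.subsetT | exact: imsetS]. Qed.

(** An image that is not yet fixed loses an element at the next step. If this happened [#|I|] times,
    only the empty set would be left, and it is fixed too. *)
Lemma iter_image_fixed k : #|I| <= k -> h @: iter_image k = iter_image k.
Proof.
move=> Ik.
have [//|] : h @: iter_image k = iter_image k \/ #|iter_image k| + k <= #|I|.
  elim: k {Ik} => [|k IHk]; first by right; rewrite addn0 max_card.
  have [E|V'V] := eqVneq (h @: iter_image k) (iter_image k).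
    by left; rewrite /iter_image iterS -/(iter_image k) !E.
  case: IHk => [/eqP|IHk]; first by rewrite (negPf V'V).
  right; have : #|h @: iter_image k| < #|iter_image k|.
    by apply: proper_card; rewrite finset.properEneq V'V iter_image_sub.
  by rewrite /iter_image iterS -/(iter_image k); lia.
have [-> _|[i iV] cV] := finset.set_0Vmem (iter_image k); first by rewrite finset.imset0.
by have : 0 < #|iter_image k| by [apply/card_gt0P; exists i]; lia.
Qed.

End IteratedImage.

(** * Deformation retracts of geometric realizations *)

Lemma continuous_pair (T U V : topologicalType) (f : T -> U) (g : T -> V) :
  continuous f -> continuous g -> continuous (fun z => (f z, g z)).
Proof.
move=> cf cg z.
by apply: (@cvg_pair _ _ _ _ (nbhs (f z)) (nbhs (g z))); [exact: cf | exact: cg].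
Qed.

Lemma continuous_compose (T U V : topologicalType) (f : T -> U) (g : U -> V) :
  continuous f -> continuous g -> continuous (fun z => g (f z)).
Proof. by move=> cf cg z; apply: (@continuous_comp _ _ _ f g); [exact: cf | exact: cg]. Qed.

Lemma continuous_snd (T U : topologicalType) : continuous (@snd T U).
Proof. by case=> t u; exact: cvg_snd. Qed.

Lemma continuous_fst (T U : topologicalType) : continuous (@fst T U).
Proof. by case=> t u; exact: cvg_fst. Qed.

Section DeformationRetract.
Variables (R : realType) (n : nat).
Implicit Types (A B C : set 'rV[R]_n) (x : 'rV[R]_n) (t : R).

(* The homotopy is continuous on the whole ambient space, so that homotopies can
   be concatenated without a pasting lemma. *)
Definition deformation_retract A B : Prop :=
  A `<=` B /\ exists G : R * 'rV[R]_n -> 'rV[R]_n,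
  [/\ continuous G, forall x, G (0, x) = x,
      forall t x, 0 <= t <= 1 -> B x -> B (G (t, x)),
      forall x, B x -> A (G (1, x)) &
      forall t x, A x -> G (t, x) = x].

Lemma deformation_retract_refl A : deformation_retract A A.
Proof.
by split=> //; exists snd; split=> //; exact: continuous_snd.
Qed.

(** Clamped time makes a concatenation of homotopies a single formula, in which each one rests
    outside its own half of the unit interval. *)
Definition clamp t : R := Num.max 0 (Num.min 1 t).

Lemma clamp_itv t : 0 <= clamp t <= 1.
Proof. by rewrite le_max lexx ge_max ler01 ge_min lexx. Qed.

Lemma clamp0 t : t <= 0 -> clamp t = 0.
Proof. by move=> t0; apply/max_idPl; rewrite ge_min t0 orbT. Qed.

Lemma clamp1 t : 1 <= t -> clamp t = 1.
Proof. by move=> t1; rewrite /clamp; have /min_idPl -> := t1; apply/max_idPr. Qed.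

Lemma continuous_clamp : continuous clamp.
Proof.
move=> t; apply: (@continuous_max R _ (cst 0) (fun t => Num.min 1 t)); first exact: cvg_cst.
by apply: (@continuous_min R _ (cst 1) id); [exact: cvg_cst | exact: cvg_id].
Qed.

Lemma continuous_clamp_affine (a b : R) :
  continuous (fun tx : R * 'rV[R]_n => clamp (a * tx.1 + b)).
Proof.
move=> tx; apply: (@continuous_comp _ _ _ (fun tx : R * _ => a * tx.1 + b)); last first.
  exact: continuous_clamp.
apply: (@cvgD _ R^o); last exact: cvg_cst.
by apply: (@cvgM R); [exact: cvg_cst | exact: continuous_fst].
Qed.

Lemma deformation_retract_trans A B C :
  deformation_retract A B -> deformation_retract B C -> deformation_retract A C.
Proof.
move=> [AB [G [cG G0 GB GA GAid]]] [BC [H [cH H0 HC HB HBid]]].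
split; first exact: subset_trans BC.
exists (fun tx => G (clamp (2 * tx.1 + -1), H (clamp (2 * tx.1 + 0), tx.2))); split.
- apply: continuous_compose cG; apply: continuous_pair.
    exact: continuous_clamp_affine.
  apply: continuous_compose cH; apply: continuous_pair.
    exact: continuous_clamp_affine.
  exact: continuous_snd.
- by move=> x /=; rewrite !clamp0 ?H0 ?G0 //; lra.
- move=> t x /andP[t0 t1] xC /=.
  (* In the first half [G] is still the identity and [H] moves inside [C]; in the second half [H]
     has arrived in [B], where [G] moves. *)
  have [t2|t2] := leP (2 * t) 1.
    by rewrite (@clamp0 (_ + -1)) ?G0; [apply: HC => //; exact: clamp_itv | lra].
  rewrite (@clamp1 (_ + 0)); last by lra.
  by apply/BC/GB; [exact: clamp_itv | exact: HB].
- by move=> x xC /=; rewrite !clamp1; [apply/GA/HB | lra | lra].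
- by move=> t x xA /=; rewrite HBid ?GAid //; exact: AB.
Qed.

Lemma deformation_retract_equivalence A B :
  deformation_retract A B -> homotopy_equivalence R A B idfun.
Proof.
move=> [AB [G [cG G0 GB GA GAid]]].
have cid D : {within D, continuous (@idfun 'rV[R]_n)} by apply: continuous_subspaceT => x.
have cG1 : continuous (fun x => G (1, x)).
  have c1 : continuous (fun x : 'rV[R]_n => (1 : R, x)).
    by apply: continuous_pair; [exact: cst_continuous | move=> x; exact: cvg_id].
  exact: continuous_compose c1 cG.
split; first by split.
exists (fun x => G (1, x)); split.
- by split; [exact: continuous_subspaceT | exact: GA].
- exists snd; split=> //= [|x xA]; last by rewrite GAid.
  by apply: continuous_subspaceT; exact: continuous_snd.
(* This homotopy has to start at [G (1, x)], so time is reversed. *)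
- exists (fun tx => G (1 - tx.1, tx.2)); split=> //=.
  + apply: continuous_subspaceT; apply: continuous_compose cG.
    apply: continuous_pair; last exact: continuous_snd.
    move=> z; apply: (@cvgB _ R^o); first exact: cvg_cst.
    exact: continuous_fst.
  + by move=> t x t01 xB; apply: GB => //; lra.
  + by move=> x xB; rewrite subr0.
  + by move=> x xB; rewrite subrr.
Qed.

Lemma continuous_row (T : topologicalType) (f : T -> 'rV[R]_n) :
  (forall j, continuous (fun z => f z ord0 j)) -> continuous f.
Proof.
move=> cf z A [P Pnbhs PA]; rewrite /= nbhs_filterE.
have : \forall z' \near z, forall j, P ord0 j (f z' ord0 j).
  by apply: filter_forall => j; apply: cf; apply: Pnbhs.
apply: filterS => z' Pz'; apply: PA => i j.
by rewrite ord1.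
Qed.

Variable rho : 'I_n -> 'I_n.

(** The linear extension of the vertex map [rho] to barycentric coordinates. *)
Definition pushforward x : 'rV[R]_n := \row_j \sum_(i | rho i == j) x ord0 i.

(* Straight-line homotopy: the contiguity hypothesis keeps [x] and its image in a
   common simplex. *)
Lemma contiguous_retract (K L : complex 'I_n) :
  (forall s, L s -> K s) ->
  (forall s, K s -> K (s :|: [set rho i | i in s])%SET /\ L [set rho i | i in s]%SET) ->
  (forall i, vertex L i -> rho i = i) ->
  deformation_retract (@realization R n L) (@realization R n K).
Proof.
move=> LK rhoK rhoL; split; first by move=> x [x0 x1 xL]; split=> //; exact: LK.
have push0 x : (forall i, 0 <= x ord0 i) -> forall i, 0 <= pushforward x ord0 i.
  by move=> x0 i; rewrite mxE; apply: sumr_ge0 => j _; apply: x0.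
have push1 x : \sum_i pushforward x ord0 i = \sum_i x ord0 i.
  rewrite [RHS](partition_big rho predT) //=.
  by apply: eq_bigr => j _; rewrite mxE.
have push_supp x j : pushforward x ord0 j != 0 ->
    j \in [set rho i | i in [set i | x ord0 i != 0]]%SET.
  rewrite mxE => sum_neq0; apply/imsetP.
  have [[i /eqP ri xi]|no] := pselect (exists2 i, rho i == j & x ord0 i != 0).
    by exists i; rewrite ?inE.
  case/negP: sum_neq0; apply/eqP; apply: big1 => i ri.
  by apply/eqP/negPn/negP => xi; apply: no; exists i.
have supp_neq0 x : \sum_i x ord0 i = 1 -> [set i | x ord0 i != 0]%SET != finset.set0.
  move=> x1; apply: contra_eq_neq x1 => s0.
  rewrite big1 ?(eq_sym 0) ?oner_eq0 // => i _.
  by have := finset.in_set0 i; rewrite -s0 inE => /negbT/negPn/eqP.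
exists (fun tx : R * 'rV[R]_n => \row_j (tx.2 ord0 j + tx.1 * (pushforward tx.2 ord0 j - tx.2 ord0 j))); split.
- have coordc j : continuous (fun tx : R * 'rV[R]_n => tx.2 ord0 j).
    apply: (continuous_compose (@continuous_snd _ _) (g := fun x : 'rV[R]_n => x ord0 j)).
    exact: coord_continuous.
  have pushc j : continuous (fun tx : R * 'rV[R]_n => pushforward tx.2 ord0 j).
    under eq_fun do rewrite mxE.
    apply: (@continuous_big _ _ +%R) => [|i _]; first exact: add_continuous.
    exact: coordc.
  apply: continuous_row => j.
  under eq_fun do rewrite mxE.
  move=> z; apply: (@cvgD _ R^o); first exact: coordc.
  apply: (@cvgM R); first exact: continuous_fst.
  apply: (@cvgB _ R^o); last exact: coordc.
  exact: pushc.
- by move=> x; apply/rowP => j; rewrite mxE /= mul0r addr0.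
- move=> t x /andP[t0 t1] [x0 x1 xK] /=; set y := (\row_j _)%R.
  have yE j : y ord0 j = (1 - t) * x ord0 j + t * pushforward x ord0 j.
    by rewrite mxE; ring.
  have y0 j : 0 <= y ord0 j by rewrite yE addr_ge0 ?mulr_ge0 ?push0 ?subr_ge0.
  have y1 : \sum_i y ord0 i = 1.
    under eq_bigr do rewrite yE.
    by rewrite big_split /= -!mulr_sumr push1 x1 !mulr1 subrK.
  split=> //; have [xK' _] := rhoK _ xK.
  apply: simplex_sub xK' _ (supp_neq0 _ y1).
  apply/fintype.subsetP => j; rewrite finset.in_setU !inE yE => yj.
  have [xj|//] := eqVneq (x ord0 j) 0; apply: push_supp.
  by apply: contraNneq yj => ->; rewrite xj !mulr0 addr0.
- move=> x [x0 x1 xK] /=; set y := (\row_j _)%R.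
  have -> : y = pushforward x by apply/rowP => j; rewrite mxE mul1r addrC subrK.
  split; [exact: push0 | by rewrite push1 |].
  have [_ xL] := rhoK _ xK; apply: simplex_sub xL _ _.
    by apply/fintype.subsetP => j; rewrite inE => /push_supp.
  by apply: supp_neq0; rewrite push1.
- move=> t x [x0 x1 xL]; apply/rowP => j; rewrite mxE /=.
  suff -> : pushforward x = x by rewrite subrr mulr0 addr0.
  have fixed i : x ord0 i != 0 -> rho i = i.
    move=> xi; apply: rhoL; apply: simplex_sub xL _ _.
      by rewrite finset.sub1set inE.
    by apply/finset.set0Pn; exists i; rewrite finset.set11.
  apply/rowP => k; rewrite mxE.
  have [xk|xk] := eqVneq (x ord0 k) 0.
    rewrite xk big1 // => i /eqP ri; apply/eqP/negPn/negP => xi.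
    by case/negP: (xi); rewrite -(fixed _ xi) ri xk.
  rewrite (bigD1 k) /= ?fixed // big1 ?addr0 // => i /andP[/eqP ri ik].
  apply/eqP/negPn/negP => xi; case/negP: ik.
  by rewrite -ri fixed.
Qed.

End DeformationRetract.

(** * Nerves of arcs given by the ranks of their endpoints *)

Section GreedyNerve.
Local Open Scope nat_scope.
Variables (R : realType) (n N : nat) (l r : 'I_n -> nat) (h : 'I_n -> 'I_n).
Variables (T : Type) (U : 'I_n -> set T).
Hypothesis lN : forall i, l i < N.
Hypothesis rN : forall i, r i < N.
Hypothesis r_inj : injective r.
Hypothesis lr : forall i j, l i != r j.
Hypothesis h_greedy : forall i j,
  cdist N (l j) (r j) + cdist N (l (h i)) (r i)
    <= cdist N (l (h i)) (r (h i)) + cdist N (l j) (r i).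
Local Notation covers := (covers N l r).
(** The only link between the sets and the positions: the nerve is read off from [covers] alone. *)
Hypothesis common_gap : forall s : {set 'I_n}, s != finset.set0 ->
  (exists x, forall i, i \in s -> U i x) <->
  (exists2 p, p < N & forall i, i \in s -> covers i p).

Lemma nerveE (S s : {set 'I_n}) : nerve S U s <->
  [/\ s != finset.set0, s \subset S & exists2 p, p < N & forall i, i \in s -> covers i p].
Proof. by split=> -[s0 sS] /(common_gap s0). Qed.

Lemma nerve_vertex (S : {set 'I_n}) i : vertex (nerve S U) i <-> i \in S.
Proof.
split=> [[_ +]|iS]; first by rewrite finset.sub1set.
apply/nerveE; split; first by apply/finset.set0Pn; exists i; rewrite finset.set11.
  by rewrite finset.sub1set.
exists (l i) => // j; rewrite finset.in_set1 => /eqP ->.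
by move: (lN i) (rN i) (lr i i); rewrite /covers; clear; cdist_lia.
Qed.

Lemma greedy_retract (V : {set 'I_n}) : [set h i | i in V]%SET \subset V ->
  deformation_retract (@realization R n (nerve [set h i | i in V]%SET U))
    (@realization R n (nerve V U)).
Proof.
move=> hV; set W := [set h i | i in V]%SET.
pose first_end j := [arg min_(i < j | i \in V) cdist N (l j) (r i)].
pose rho j := if j \in W then j else h (first_end j).
have first_endP j : j \in V -> first_end j \in V /\
    forall i, i \in V -> cdist N (l j) (r (first_end j)) <= cdist N (l j) (r i).
  by move=> jV; rewrite /first_end; case: arg_minnP.
have rhoW j : j \in V -> rho j \in W.
  move=> jV; rewrite /rho; case: ifP => // _.
  by apply: imset_f; case: (first_endP j jV).
(* The vertices of [q] are treated one at a time. Since the common gap moves, it must be kept inside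
   the images already obtained; these are added to the simplex in [s'], which stays in [V] because
   h(V) does. *)
have rho_gap (s : {set 'I_n}) (q : seq 'I_n) p : s \subset V -> {subset q <= s} -> p < N ->
    (forall k, k \in s -> covers k p) ->
    exists p', [/\ p' < N, forall k, k \in s -> covers k p' &
                   forall k, k \in q -> covers (rho k) p'].
  move=> sV qs pN cov; elim: q qs => [|j q IHq] qs; first by exists p.
  have [|p' [p'N p's p'q]] := IHq; first by move=> k kq; apply: qs; rewrite inE kq orbT.
  have js : j \in s by apply: qs; rewrite inE eqxx.
  have jV : j \in V by apply: (fintype.subsetP sV).
  pose s' := (s :|: [set rho k | k in q])%SET.
  have s'V : s' \subset V.
    rewrite finset.subUset sV; apply/fintype.subsetP => _ /imsetP[k kq ->].
    apply: (fintype.subsetP hV); apply: rhoW; apply: (fintype.subsetP sV); apply: qs.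
    by rewrite inE kq orbT.
  have cov' k : k \in s' -> covers k p'.
    by rewrite finset.in_setU => /orP[/p's//|/imsetP[k' /p'q ? ->]].
  have [p'' [p''N p''s' p''j]] : exists p'', [/\ p'' < N,
      forall k, k \in s' -> covers k p'' & covers (rho j) p''].
    rewrite /rho; case: ifP => _.
      by exists p'; split=> //; apply: p's.
    have [_ fmin] := first_endP j jV.
    apply: (greedy_dominates lN rN lr h_greedy fmin s'V _ p'N cov').
    by rewrite finset.in_setU js.
  exists p''; split=> // k.
    by move=> ks; apply: p''s'; rewrite finset.in_setU ks.
  rewrite inE => /predU1P[->//|kq]; apply: p''s'.
  by rewrite finset.in_setU; apply/orP; right; apply: imset_f.
apply: (@contiguous_retract R n rho (nerve V U) (nerve W U)).
- move=> s [s0 sW sx]; split=> //; exact: fintype.subset_trans hV.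
- move=> s /nerveE[s0 sV [p pN cov]].
  have [|p' [p'N p's p'rho]] := @rho_gap s (enum s) p sV _ pN cov.
    by move=> k; rewrite mem_enum.
  have rhosW : [set rho k | k in s]%SET \subset W.
    apply/fintype.subsetP => _ /imsetP[k ks ->]; apply: rhoW.
    exact: (fintype.subsetP sV).
  have cov_rho k : k \in [set rho k | k in s]%SET -> covers k p'.
    by move=> /imsetP[k' k's ->]; apply: p'rho; rewrite mem_enum.
  have [i is_] := finset.set0Pn _ s0.
  split; apply/nerveE; split.
  + by apply/finset.set0Pn; exists i; rewrite finset.in_setU is_.
  + by rewrite finset.subUset sV; apply: fintype.subset_trans hV.
  + by exists p' => // k; rewrite finset.in_setU => /orP[/p's|/cov_rho].
  + by apply/finset.set0Pn; exists (rho i); apply: imset_f.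
  + by [].
  + by exists p'.
- by move=> i /nerve_vertex iW; rewrite /rho iW.
Qed.

Lemma iter_greedy_retract k : deformation_retract
  (@realization R n (nerve (iter_image h k) U)) (@realization R n (nerve [set: 'I_n]%SET U)).
Proof.
elim: k => [|k IHk]; first exact: deformation_retract_refl.
apply: deformation_retract_trans IHk; apply: greedy_retract.
exact: iter_image_sub.
Qed.

Variable P : {set 'I_n}.
Hypothesis hP : [set h i | i in P]%SET = P.
Hypothesis P_neq0 : P != finset.set0.

Lemma periodic_nerve_iso : exists k, complex_iso (nerve P U) (cyclic_complex #|P| k).
Proof.
have m_gt0 : 0 < #|P| by rewrite card_gt0.
have [k km covk] := periodic_covers_rank lN rN r_inj lr h_greedy hP m_gt0.
exists k; set m := #|P| in m_gt0 km covk *; pose rk := rank_in r P.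
have rk_lt i : i \in P -> rk i < m by apply: rank_in_lt.
(* The remainder only makes [f] total; on [P] it is the rank. *)
pose f i : 'I_m := Ordinal (ltn_pmod (rk i) m_gt0).
have fE i : i \in P -> f i = rk i :> nat by move=> iP; rewrite /= modn_small ?rk_lt.
have surj y : y < m -> exists2 i, i \in P & rk i = y by apply: rank_in_surj.
have addmod x dd : x < m -> dd < m -> cdist m x ((x + dd) %% m) = dd.
  move=> xm dm; have [lt_m|le_m] := ltnP (x + dd) m.
    by rewrite modn_small //; move: lt_m xm; clear; cdist_lia.
  have -> : (x + dd) %% m = x + dd - m.
    by rewrite -[in LHS](subnK le_m) modnDr modn_small //; lia.
  by move: le_m xm dm; clear; cdist_lia.
have modcdist x y : x < m -> y < m -> (x + cdist m x y) %% m = y.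
  move=> xm ym; case: (cdistP xm ym) => -[xy E].
    by rewrite addnC E modn_small.
  by rewrite addnC E modnDr modn_small.
have cyc_vertex w : vertex (cyclic_complex m k) w.
  split; first by apply/finset.set0Pn; exists w; rewrite finset.set11.
  exists w; rewrite finset.sub1set inE; apply/existsP; exists ord0.
  by rewrite addn0 modn_small ?ltn_ord.
exists f; split.
- by [].
- move=> u v /nerve_vertex uP /nerve_vertex vP /(congr1 val) /=.
  rewrite !modn_small ?rk_lt //; exact: rank_in_inj.
- move=> w _; have [i iP iw] := surj w (ltn_ord w).
  by exists i; [apply/nerve_vertex | apply/val_inj; rewrite -[LHS]/(f i : nat) fE].
- move=> s sP; have {}sP i : i \in s -> i \in P by move=> /sP /nerve_vertex.
  split.
    move=> /nerveE[s0 _ [p pN cov]].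
    have [i is_ covi] := covers_last_start lN rN pN s0 cov.
    split.
      by have [j js] := finset.set0Pn _ s0; apply/finset.set0Pn; exists (f j); apply: imset_f.
    have rki := rk_lt i (sP i is_).
    (* All arcs of [s] contain the beginning of [i], so their ranks are among the [k + 1] ranks that
       finish at that of [i]; the maximal simplex starts [k] places earlier. *)
    have [x xm xk] : exists2 x, x < m & cdist m x (rk i) = k.
      have [x xm xE] : exists2 x, x < m & x + k = rk i \/ x + k = rk i + m.
        have [ki|ik] := leqP k (rk i).
          by exists (rk i - k); [lia | left; lia].
        by exists (rk i + m - k); [lia | right; lia].
      by exists x => //; move: xE xm rki km; clear; cdist_lia.
    exists (Ordinal xm); apply/fintype.subsetP => _ /imsetP[j js ->].
    rewrite inE; apply/existsP.
    have := covi j js; rewrite covk ?sP // -/(rk j) -/(rk i) => dji.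
    have rkj := rk_lt j (sP j js).
    have dk : cdist m x (rk j) < k.+1.
      by move: dji xk rki rkj xm; clear; cdist_lia.
    by exists (Ordinal dk); rewrite /= modcdist // modn_small.
  move=> [fs0 [x sx]]; apply/nerveE.
  have s0 : s != finset.set0.
    by apply: contraNneq fs0 => ->; rewrite finset.imset0.
  split=> //; first by apply/fintype.subsetP.
  (* The arc at the last place [x + k]: its beginning lies in all arcs at the places [x], ...,
     [x + k]. *)
  have [i iP ik] := surj _ (ltn_pmod (x + k) m_gt0).
  exists (l i) => // j js; rewrite covk ?(sP j) // -/(rk i) -/(rk j) ik.
  have /(fintype.subsetP sx) : f j \in [set f v | v in s]%SET by apply: imset_f.
  rewrite inE => /existsP[dd /eqP E].
  have := fE j (sP j js); rewrite -E => Ej.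
  have ddk : dd <= k by rewrite -ltnS.
  have := addmod x k (ltn_ord x) km; have := addmod x dd (ltn_ord x) (leq_ltn_trans ddk km).
  move: (ltn_pmod (x + k) m_gt0) (ltn_pmod (x + dd) m_gt0) (ltn_ord x) ddk.
  by rewrite Ej; clear; cdist_lia.
Qed.

End GreedyNerve.

(** * Families in which one arc is the whole circle *)

Section FullArc.
Local Open Scope nat_scope.
Variables (R : realType) (n : nat) (T : Type) (U : 'I_n -> set T) (i0 : 'I_n) (x0 : T).
Hypothesis Ui0 : forall x, U i0 x.

Lemma full_vertexE v : vertex (nerve [set i0]%SET U) v <-> v = i0.
Proof.
split=> [[_ + _]|->]; first by rewrite finset.sub1set finset.in_set1 => /eqP.
split=> //; first by apply/finset.set0Pn; exists i0; rewrite finset.set11.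
by exists x0 => i; rewrite finset.in_set1 => /eqP ->.
Qed.

(** The full arc is a cone vertex: adding it to a simplex keeps the common point, so the constant
    map is contiguous to the identity. *)
Lemma full_arc_retract : deformation_retract (@realization R n (nerve [set i0]%SET U))
  (@realization R n (nerve [set: 'I_n]%SET U)).
Proof.
apply: (@contiguous_retract R n (fun=> i0)).
- by move=> s [s0 si0 sx]; split=> //; exact: finset.subsetT.
- move=> s [s0 _ [x sx]]; have [i is_] := finset.set0Pn _ s0.
  have img : [set i0 | _ in s]%SET = [set i0]%SET.
    apply/setP => j; rewrite finset.in_set1; apply/imsetP/eqP => [[]//|->].
    by exists i.
  rewrite img; split.
    split; [|exact: finset.subsetT|exists x => j].
      by apply/finset.set0Pn; exists i; rewrite finset.in_setU is_.
    by rewrite finset.in_setU finset.in_set1 => /orP[/sx|/eqP ->].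
  exact/full_vertexE.
- by move=> i /full_vertexE.
Qed.

Lemma full_arc_iso : complex_iso (nerve [set i0]%SET U) (cyclic_complex #|[set i0]%SET| 0).
Proof.
rewrite cards1; exists (fun=> ord0).
have vert w : vertex (cyclic_complex 1 0) w.
  split; first by apply/finset.set0Pn; exists w; rewrite finset.set11.
  by exists w; rewrite finset.sub1set inE; apply/existsP; exists ord0; rewrite ord1.
split=> [//|u v /full_vertexE -> /full_vertexE ->//|w _|s si0].
  exists i0; [exact/full_vertexE | by rewrite (ord1 w)].
split=> [[s0 _ _]|[s0 _]].
  have [i is_] := finset.set0Pn _ s0.
  have -> : [set (ord0 : 'I_1) | _ in s]%SET = [set ord0]%SET; last exact: vert.
  apply/setP => j; rewrite finset.in_set1 ord1 eqxx; apply/imsetP.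
  by exists i.
have {}s0 : s != finset.set0 by apply: contraNneq s0 => ->; rewrite finset.imset0.
have -> : s = [set i0]%SET; last exact/full_vertexE.
apply/eqP; rewrite finset.eqEsubset finset.sub1set; apply/andP; split.
  by apply/fintype.subsetP => j /si0 /full_vertexE ->; rewrite finset.set11.
by have [i is_] := finset.set0Pn _ s0; move: (is_); have /full_vertexE -> := si0 _ is_.
Qed.

End FullArc.

(** * Arcs in coordinates *)

Section UnitTurn.
Variable R : realType.
Implicit Types (b t u v x lo hi : R) (k p q : int) (a : arc R).

Lemma frac_part_itv t : 0 <= frac_part t < 1.
Proof. by have := floor_itv t; rewrite /frac_part intrD; lra. Qed.

Lemma int_shift_bounds k (m m' : int) : (m%:~R : R) < k%:~R -> (k%:~R : R) < m'%:~R -> m < k < m'.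
Proof. by rewrite !ltr_int => -> ->. Qed.

Lemma unit_turn_unique t u k : 0 <= t < 1 -> 0 <= u < 1 -> t = u + k%:~R -> t = u.
Proof.
move=> t01 u01 E; have : (-1 < k < 1)%R by apply: int_shift_bounds; rewrite ?rmorphN /=; lra.
move=> k01; have k0 : k = 0 by lia.
by rewrite E k0 addr0.
Qed.

(** Here [u], [v] are the coordinates of the endpoints from the base point [b], and [p], [q] the
    turns they are on. An arc of at most one turn has [q - p] equal to 0 or 1, which tells whether
    it wraps past the base point. If [u = v], the ends decide: by hypothesis an arc of length 0 is
    closed, and one of length 1 is open at both ends. *)
Lemma lift_in_arc b u v x p q a :
  lo a = b + u + p%:~R -> hi a = b + v + q%:~R -> 0 <= u < 1 -> 0 <= v < 1 -> 0 <= x < 1 ->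
  hi a <= lo a + 1 ->
  (lo a = hi a -> lo_in a && hi_in a) -> (hi a = lo a + 1 -> ~~ lo_in a && ~~ hi_in a) ->
  let passed_lo := (u < x) || (u == x) && lo_in a in
  let passed_hi := (v < x) || (v == x) && ~~ hi_in a in
  (exists k : int, b + x + k%:~R \in arc_itv a) <->
  (if (u < v) || (u == v) && (lo_in a && hi_in a) then passed_lo && ~~ passed_hi
   else passed_lo || ~~ passed_hi).
Proof.
case: a => l h li hi_ lh; rewrite /arc_itv /=.
move=> El Eh u01 v01 x01 hl1 pt turn.
have itvE t : (t \in Interval (BSide li l) (BSide (~~ hi_) h)) =
    ((l < t) || (l == t) && li) && ((t < h) || (t == h) && hi_).
  by rewrite in_itv /= /Order.lteif; case: li {turn pt}; case: hi_;
    rewrite ?andbT ?andbF ?orbF // ?le_eqVlt ?(orbC (_ == _)).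
have M01 : -1 < q - p < 2.
  by apply: int_shift_bounds; rewrite rmorphB ?rmorphN /=; lra.
have ME : v + (q - p)%:~R - u = h - l by rewrite rmorphB /=; lra.
have memE k : (b + x + k%:~R \in Interval (BSide li l) (BSide (~~ hi_) h)) =
    ((u < x + (k - p)%:~R) || (u == x + (k - p)%:~R) && li) &&
    ((x + (k - p)%:~R < v + (q - p)%:~R) || (x + (k - p)%:~R == v + (q - p)%:~R) && hi_).
  rewrite itvE El Eh rmorphB /= rmorphB /=.
  congr ((_ || _ && _) && (_ || _ && _)); apply/idP/idP => ?; lra.
have out k : ~~ (-1 < k - p < 2) ->
    b + x + k%:~R \in Interval (BSide li l) (BSide (~~ hi_) h) = false.
  move=> /negP K01; apply/negP; rewrite memE => /andP[uk kv]; apply: K01.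
  have {}uk : u <= x + (k - p)%:~R by case/orP: uk => [/ltW|/andP[/eqP <-]].
  have {}kv : x + (k - p)%:~R <= v + (q - p)%:~R by case/orP: kv => [/ltW|/andP[/eqP <-]].
  by apply: int_shift_bounds; rewrite ?rmorphN /=; lra.
have kp0 : p - p = 0 by rewrite subrr.
have kp1 : p + 1 - p = 1 by rewrite addrAC subrr add0r.
have [M0|M1] : q - p = 0 \/ q - p = 1 by lia.
- have -> : (u < v) || (u == v) && (li && hi_).
    have [//|vu|uv] := ltgtP u v; first by move: ME; rewrite M0; lra.
    by apply: pt; move: ME; rewrite M0 uv; lra.
  have mem0 k : k - p = 0 -> (b + x + k%:~R \in Interval (BSide li l) (BSide (~~ hi_) h)) =
      ((u < x) || (u == x) && li) && ~~ ((v < x) || (v == x) && ~~ hi_).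
    move=> k0; rewrite memE M0 k0 !addr0; congr (_ && _).
    by case: ltgtP; rewrite ?andbF //=; case: hi_ {turn pt itvE memE out}.
  split=> [[k]|H]; last by exists p; rewrite mem0.
  have [K01|K01] := boolP (-1 < k - p < 2); last by rewrite out.
  have [K0|K1] : k - p = 0 \/ k - p = 1 by lia.
    by rewrite mem0.
  rewrite memE M0 K1 addr0 => /andP[_ /orP[|/andP[/eqP]]]; lra.
- have -> : (u < v) || (u == v) && (li && hi_) = false.
    have [uv|//|uv] := ltgtP u v; first by move: ME; rewrite M1; lra.
    have /turn : h = l + 1 by move: ME; rewrite M1 uv; lra.
    by case: li {pt turn itvE memE out}.
  split=> [[k]|].
    have [K01|K01] := boolP (-1 < k - p < 2); last by rewrite out.
    have [K0|K1] : k - p = 0 \/ k - p = 1 by lia.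
      by rewrite memE K0 addr0 => /andP[-> _].
    rewrite memE M1 K1 => /andP[_ H]; apply/orP; right; move: H.
    rewrite ltrD2r (inj_eq (addIr _)).
    by case: ltgtP; rewrite ?andbF //=; case: hi_ {turn pt itvE memE out}.
  case/orP=> H.
    exists p; rewrite memE kp0 M1 addr0 H /=; apply/orP; left; lra.
  exists (p + 1); rewrite memE kp1 M1; apply/andP; split.
    by apply/orP; left; lra.
  rewrite ltrD2r (inj_eq (addIr _)); move: H.
  by case: ltgtP; rewrite ?andbF //=; case: hi_ {turn pt itvE memE out}.
Qed.

End UnitTurn.

(** * Points of an arc in terms of cuts *)

Section ArcMembership.
Variable R : realType.
Implicit Types (a : arc R) (b x : circle R) (t : R).

Definition coord b x : R := frac_part (repr x - repr b).

Lemma coord_itv b x : 0 <= coord b x < 1.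
Proof. exact: frac_part_itv. Qed.

Lemma pi_circleP t t' : \pi_(circle R) t = \pi_(circle R) t' <-> exists k : int, t = t' + k%:~R.
Proof.
split=> [/eqmodP /intrP[k E]|[k ->]]; first by exists k; rewrite -E addrC subrK.
by apply/eqmodP; rewrite /= /eq_mod1 addrAC subrr add0r intr_int.
Qed.

Lemma coord_lift b t : exists k : int, t = repr b + coord b (\pi_(circle R) t) + k%:~R.
Proof.
have /pi_circleP[k] : \pi_(circle R) t = \pi_(circle R) (repr (\pi_(circle R) t)).
  by rewrite reprK.
rewrite /coord /frac_part; move: (repr (\pi_(circle R) t)) (repr b) => y c ->.
by exists (k + Num.floor (y - c)); rewrite intrD; lra.
Qed.

Lemma coord_pi b t : 0 <= t < 1 -> coord b (\pi_(circle R) (repr b + t)) = t.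
Proof.
move=> t01; have [k E] := coord_lift b (repr b + t).
have c01 := coord_itv b (\pi_(circle R) (repr b + t)).
apply/esym; apply: (@unit_turn_unique R _ _ k) => //.
by move: E; rewrite -addrA => /addrI.
Qed.

(** An arc of exactly one turn that is open at both ends misses a point, hence the second
    alternative. The negated comparisons are those of [LeTurn] and [LtTurn]. *)
Definition full_arc a : bool :=
  ~~ (hi a <= lo a + 1) || ~~ (hi a < lo a + 1) && (lo_in a || hi_in a).

Lemma full_arcP a x : full_arc a -> arc_set a x.
Proof.
case: a => l h li hi_ lh; rewrite /full_arc /arc_set /arc_itv /= => full.
set f := frac_part (repr x - l); have f01 : 0 <= f < 1 := frac_part_itv _.
have xE (k : int) : \pi_(circle R) (l + f + k%:~R) = x.
  rewrite -[RHS]reprK; apply/pi_circleP.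
  exists (k - Num.floor (repr x - l)); rewrite /f /frac_part rmorphB /=.
  by move: (repr x) => y; lra.
have [lt_hi|le_hi] := ltP (l + 1) h.
  have [f0|f_gt0] := eqVneq f 0.
    exists (l + f + 1%:~R) => //; rewrite /= in_itv /= /Order.lteif f0.
    by case: li {full}; case: hi_ {xE}; rewrite /=; lra.
  exists (l + f + 0%:~R) => //; rewrite /= in_itv /= /Order.lteif.
  have {}f_gt0 : 0 < f by rewrite lt_def f_gt0; case/andP: f01.
  by case: li {full}; case: hi_ {xE}; rewrite /=; lra.
have {full} [lh1 ends] : l + 1 <= h /\ (li || hi_).
  by move: full; rewrite le_hi /= -leNgt => /andP[].
case: li ends => [_|/= ->].
  exists (l + f + 0%:~R) => //; rewrite /= in_itv /= /Order.lteif.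
  by case: hi_ {xE}; rewrite /=; lra.
have [f0|f_gt0] := eqVneq f 0.
  by exists (l + f + 1%:~R) => //; rewrite /= in_itv /= /Order.lteif f0 {xE}; lra.
exists (l + f + 0%:~R) => //; rewrite /= in_itv /= /Order.lteif {xE}.
by have {}f_gt0 : 0 < f by [rewrite lt_def f_gt0; case/andP: f01]; lra.
Qed.

(* Cuts of the circle at the coordinate [x]: just before the point for tags 0, 1
   and just after it for tags 2, 3. Among cuts at the same place the ends of arcs
   (even tags) precede the beginnings. *)
Definition cut_tag (s : side) a : nat :=
  match s with
  | Lo => if lo_in a then 1 else 3
  | Hi => if hi_in a then 2 else 0
  end.

Definition cut_lt b (s s' : side) a a' : bool :=
  let u := coord b (endpoint s a) in let u' := coord b (endpoint s' a') in
  (u < u') || (u == u') && (cut_tag s a < cut_tag s' a')%N.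

Definition cut_passed b (s : side) a (x : R) : bool :=
  (coord b (endpoint s a) < x) || (coord b (endpoint s a) == x) && (cut_tag s a <= 1)%N.

(** The cut order of the two ends tells whether the arc wraps past the base point. At equal
    coordinates the tags decide: a single point has tags 1 and 2, an open arc of one turn has tags 3
    and 0. *)
Lemma mem_arc b a x : arc_set a !=set0 -> ~~ full_arc a ->
  arc_set a x <->
  (if cut_lt b Lo Hi a a
   then cut_passed b Lo a (coord b x) && ~~ cut_passed b Hi a (coord b x)
   else cut_passed b Lo a (coord b x) || ~~ cut_passed b Hi a (coord b x)).
Proof.
move=> a0; rewrite negb_or negbK => /andP[le1 lt1].
have [p Ep] := coord_lift b (lo a); have [q Eq] := coord_lift b (hi a).
have lh : lo a <= hi a by case: (a).
have := @lift_in_arc R (repr b) (coord b (endpoint Lo a)) (coord b (endpoint Hi a)) (coord b x)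
  p q a Ep Eq (coord_itv _ _) (coord_itv _ _) (coord_itv _ _) le1.
have memE : arc_set a x <-> exists k : int, repr b + coord b x + k%:~R \in arc_itv a.
  have [k0 E0] := coord_lift b (repr x); rewrite reprK in E0.
  split=> [[t ta tx]|[k ka]].
    have [k E] := coord_lift b t; exists k.
    by rewrite -tx -E.
  exists (repr b + coord b x + k%:~R) => //.
  rewrite -[RHS]reprK; apply/pi_circleP; exists (k - k0).
  by rewrite E0 rmorphB /=; move: (repr b + coord b x) => c; clear; lra.
have pt : lo a = hi a -> lo_in a && hi_in a.
  move=> lo_hi; case: a0 => _ [t + _]; rewrite /= /arc_itv lo_hi in_itv /=.
  rewrite /Order.lteif; case: (lo_in a); case: (hi_in a) => //=; lra.
have turn : hi a = lo a + 1 -> ~~ lo_in a && ~~ hi_in a.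
  by move=> E; move: lt1; rewrite E ltxx /= negb_or.
move=> /(_ pt turn) /= [H1 H2].
have tag_lo : (cut_tag Lo a <= 1)%N = lo_in a by rewrite /=; case: (lo_in a).
have tag_hi : (cut_tag Hi a <= 1)%N = ~~ hi_in a by rewrite /=; case: (hi_in a).
have tag_lt : (cut_tag Lo a < cut_tag Hi a)%N = lo_in a && hi_in a.
  by rewrite /=; case: (lo_in a); case: (hi_in a).
rewrite /cut_lt /cut_passed tag_lo tag_hi tag_lt.
by split=> [/memE /H1|/H2 /memE].
Qed.

End ArcMembership.

(** * Common points and common gaps *)

Section CommonGap.
Variables (R : realType) (n N : nat) (U : 'I_n -> arc R) (b : circle R).
Variable rk : side -> 'I_n -> nat.
Hypothesis U_neq0 : forall i, arc_set (U i) !=set0.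
Hypothesis U_nonfull : forall i, ~~ full_arc (U i).
Hypothesis rkN : forall s i, (rk s i < N)%N.
Hypothesis rk_lt : forall s s' i j, cut_lt b s s' (U i) (U j) -> (rk s i < rk s' j)%N.
Hypothesis rk_lo_neq_hi : forall i j, rk Lo i != rk Hi j.
Local Notation covers := (covers N (rk Lo) (rk Hi)).
Local Notation passed s i x := (cut_passed b s (U i) x).

Lemma passed_mono s s' i j x : (rk s i <= rk s' j)%N -> passed s' j x -> passed s i x.
Proof.
move=> le_rk; have : ~~ cut_lt b s' s (U j) (U i).
  by apply/negP => /rk_lt; rewrite ltnNge le_rk.
rewrite /cut_lt /cut_passed; set u := coord _ _; set v := coord _ _.
rewrite negb_or -leNgt negb_and -leqNgt => /andP[vu ties].
case/orP=> [ux|/andP[/eqP ux tag_u]]; first by rewrite (le_lt_trans vu ux).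
rewrite -ux; move: vu; rewrite le_eqVlt => /predU1P[vu|-> //].
by rewrite vu eqxx ltxx /=; move: ties; rewrite vu eqxx /=; lia.
Qed.

(** Beginnings have odd tags and ends even ones, so a beginning and an end never tie, while two
    beginnings may tie and be ranked in either order. *)
Lemma rk_lo_hi i j : ((rk Lo i < rk Hi j)%N -> cut_lt b Lo Hi (U i) (U j)).
Proof.
move=> lt_rk; have : ~~ cut_lt b Hi Lo (U j) (U i).
  by apply/negP => /rk_lt; rewrite ltnNge ltnW.
rewrite /cut_lt; set u := coord _ _; set v := coord _ _.
case: ltgtP => //= _; rewrite /cut_tag.
by case: (lo_in _); case: (hi_in _).
Qed.

Lemma mem_arc_rk i x : arc_set (U i) x <->
  (if (rk Lo i < rk Hi i)%N
   then passed Lo i (coord b x) && ~~ passed Hi i (coord b x)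
   else passed Lo i (coord b x) || ~~ passed Hi i (coord b x)).
Proof.
suff <- : cut_lt b Lo Hi (U i) (U i) = (rk Lo i < rk Hi i)%N by exact: mem_arc.
by apply/idP/idP => [/rk_lt|/rk_lo_hi].
Qed.

Lemma gap_of_point (s : {set 'I_n}) x : s != finset.set0 ->
  (forall i, i \in s -> arc_set (U i) x) ->
  exists2 p, (p < N)%N & forall i, i \in s -> covers i p.
Proof.
move=> /finset.set0Pn[i0 _] sx.
(* [p] is the highest rank of a cut passed by the point. If none is passed, the point is in the gap
   [N.-1], which wraps around to rank 0. *)
have [p pN pE] : exists2 p, (p < N)%N &
    (forall s i, passed s i (coord b x) = (rk s i <= p)%N) \/
    p = N.-1 /\ (forall s i, passed s i (coord b x) = false).
  have [[s1 [i1 pass1]]|none] := pselect (exists s i, passed s i (coord b x)); last first.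
    exists N.-1; first by have := rkN Lo i0; lia.
    by right; split=> // s' i; apply/negP => pass; apply: none; exists s', i.
  have ubN p : `[< exists s i, passed s i (coord b x) /\ rk s i = p >] -> (p <= N)%N.
    by move=> /asboolP[s' [i [_ <-]]]; apply: ltnW.
  have exP : exists p, `[< exists s i, passed s i (coord b x) /\ rk s i = p >].
    by exists (rk s1 i1); apply/asboolP; exists s1, i1.
  have [p /asboolP[s' [i [pass E]]] pmax] := ex_maxnP exP ubN.
  exists p; first by rewrite -E.
  left=> s'' j; apply/idP/idP => [passj|].
    by apply: pmax; apply/asboolP; exists s'', j.
  by rewrite -E => /passed_mono; apply.
exists p => // i is_; have /mem_arc_rk := sx i is_; rewrite /covers.
case: pE => [pE|[-> pE]]; rewrite !pE.
  by move: (rk_lo_neq_hi i i) (rkN Lo i) (rkN Hi i) pN; clear; case: ifP; cdist_lia.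
have pN' : (N.-1 < N)%N by have := rkN Lo i0; lia.
by move: (rk_lo_neq_hi i i) (rkN Lo i) (rkN Hi i) pN'; clear; case: ifP => //; cdist_lia.
Qed.

Lemma point_of_gap (s : {set 'I_n}) :
  s != finset.set0 ->
  (exists2 p, (p < N)%N & forall i, i \in s -> covers i p) ->
  exists x, forall i, i \in s -> arc_set (U i) x.
Proof.
move=> s0 [p pN cov].
have [i is_ covi] := covers_last_start (rkN Lo) (rkN Hi) pN s0 cov.
(* In [s], [i] begins last before the gap and [j] ends first after that beginning; a point between
   these two cuts lies in every arc of [s]. *)
have [j js jmin] := @arg_minnP _ i (mem s) (fun j => cdist N (rk Lo i) (rk Hi j)) is_.
have [x [x01 pass_i npass_j]] : exists x, [/\ 0 <= x < 1, passed Lo i x &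
    (rk Lo i < rk Hi j)%N -> ~~ passed Hi j x].
  have u01 := coord_itv b (endpoint Lo (U i)); have v01 := coord_itv b (endpoint Hi (U j)).
  have [lt_ij|_] := boolP (rk Lo i < rk Hi j)%N; last first.
    (* In this case all arcs of [s] wrap past the base point and have begun by the beginning of [i],
       so any coordinate between that beginning and 1 will do. *)
    exists ((coord b (endpoint Lo (U i)) + 1) / 2).
    rewrite /cut_passed; move: (coord b _) u01 => u u01.
    by split=> //; [lra | apply/orP; left; lra].
  have := rk_lo_hi lt_ij; rewrite /cut_lt /cut_passed.
  move: (coord b (endpoint Lo (U i))) (coord b (endpoint Hi (U j))) u01 v01 => u v u01 v01.
  case/orP=> [uv|/andP[/eqP uv tags]].
    exists ((u + v) / 2); split; first by lra.
      by apply/orP; left; lra.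
    by move=> _; apply/negP => /orP[|/andP[/eqP]]; lra.
  (* At equal coordinates the tags can only be 1 and 2: both ends are closed, and the point itself
     is common. *)
  exists u; rewrite -uv eqxx ltxx /= -ltnNge; split=> //.
    by move: tags; rewrite /=; case: (lo_in _); case: (hi_in _).
  by move: tags; rewrite /=; case: (lo_in _); case: (hi_in _).
exists (\pi_(circle R) (repr b + x)) => k ks; apply/mem_arc_rk; rewrite coord_pi //.
have := covi k ks; have := jmin k ks; rewrite /covers.
have pass_k : (rk Lo k <= rk Lo i)%N -> passed Lo k x by move=> /passed_mono; apply.
have npass_k : (rk Lo i < rk Hi j)%N -> (rk Hi j <= rk Hi k)%N -> ~~ passed Hi k x.
  by move=> ij jk; apply: contra (npass_j ij); apply: passed_mono.
move: pass_k npass_k (rkN Lo k) (rkN Hi k) (rkN Lo i) (rkN Hi j).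
move: (rk_lo_neq_hi k k) (rk_lo_neq_hi i j) (rk_lo_neq_hi i k) (rk_lo_neq_hi k j).
move: (passed Lo k x) (passed Hi k x) => pl ph.
clear; case: ifP => lk Dkk Dij Dik Dkj pass_k npass_k lkN rkN liN rjN jmin cov.
- have [ki [ij jk]] : (rk Lo k <= rk Lo i)%N /\ (rk Lo i < rk Hi j)%N /\ (rk Hi j <= rk Hi k)%N.
    by move: lk Dkk Dij Dik Dkj lkN rkN liN rjN jmin cov; clear; cdist_lia.
  by rewrite pass_k // npass_k.
- have [ki|[ij jk]] : (rk Lo k <= rk Lo i)%N \/ ((rk Lo i < rk Hi j)%N /\ (rk Hi j <= rk Hi k)%N).
    by move: lk Dkk Dij Dik Dkj lkN rkN liN rjN jmin cov; clear; cdist_lia.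
  + by rewrite pass_k.
  + by rewrite npass_k ?orbT.
Qed.

End CommonGap.

(** * Total correctness with running times *)

Section Runs.
Local Open Scope nat_scope.
Variables (R : realType) (n : nat) (U : 'I_n -> arc R).

Definition runs (p : prog) (st : state) (T : nat) (Q : state -> Prop) : Prop :=
  exists t st', [/\ exec U p st t st', t <= T & Q st'].

Lemma runs_weaken p st T T' (Q Q' : state -> Prop) :
  runs p st T Q -> T <= T' -> (forall st', Q st' -> Q' st') -> runs p st T' Q'.
Proof.
move=> [t [st' [ex tT Qst]]] TT' QQ'; exists t, st'.
by split=> //; [exact: leq_trans TT' | exact: QQ'].
Qed.

Lemma runs_seq p1 p2 st T1 T2 (Q1 Q : state -> Prop) :
  runs p1 st T1 Q1 -> (forall st1, Q1 st1 -> runs p2 st1 T2 Q) ->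
  runs (Seq p1 p2) st (T1 + T2) Q.
Proof.
move=> [t1 [st1 [ex1 tT1 Qst1]]] /(_ _ Qst1)[t2 [st2 [ex2 tT2 Qst2]]].
by exists (t1 + t2), st2; split=> //; [exact: exec_seq ex2 | exact: leq_add].
Qed.

Lemma runs_if b p1 p2 st T Q :
  runs (if eval_test U st b then p1 else p2) st T Q ->
  runs (If b p1 p2) st (test_cost b + T).+1 Q.
Proof.
move=> [t [st' [ex tT Qst]]]; exists (test_cost b + t).+1, st'.
by split=> //; [exact: exec_if | rewrite ltnS leq_add2l].
Qed.

Lemma runs_while (Inv : nat -> state -> Prop) b p m c st :
  (forall k st, k < m -> Inv k st -> eval_test U st b /\ runs p st c (Inv k.+1)) ->
  (forall st, Inv m st -> ~~ eval_test U st b) ->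
  Inv 0 st -> runs (While b p) st (m * (test_cost b + c).+1 + (test_cost b).+1) (Inv m).
Proof.
move=> step stop.
suff H d st0 : d <= m -> Inv (m - d) st0 ->
    runs (While b p) st0 (d * (test_cost b + c).+1 + (test_cost b).+1) (Inv m).
  by have := H m st (leqnn m); rewrite subnn.
elim: d st0 => [|d IHd] st0 dm.
  rewrite subn0 => I0; exists (test_cost b).+1, st0.
  by split=> //; apply: exec_while_false; apply: stop.
move=> Id; have [|bt [t1 [st1 [ex1 t1c]]]] := step _ _ _ Id; first by lia.
rewrite -subSn // subSS => I1; have [|t2 [st2 [ex2 t2c I2]]] := IHd _ _ I1; first by lia.
exists (test_cost b + t1 + t2).+1, st2; split=> //; first exact: exec_while_true ex2.
by rewrite mulSn; lia.
Qed.

Fixpoint loop_free (p : prog) : bool :=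
  match p with
  | Seq p1 p2 | If _ p1 p2 => loop_free p1 && loop_free p2
  | While _ _ => false
  | _ => true
  end.

(* Junk value on loops: only used for loop-free programs. *)
Fixpoint final (p : prog) (st : state) : state :=
  match p with
  | Skip | While _ _ => st
  | Assign x e => State (upd (var st) x (eval_expr st e)) (arr st)
  | Put a e1 e2 => State (var st)
      (upd (arr st) a (upd (arr st a) (eval_expr st e1) (eval_expr st e2)))
  | Seq p1 p2 => final p2 (final p1 st)
  | If b p1 p2 => if eval_test U st b then final p1 st else final p2 st
  end.

End Runs.

(** A conditional is charged its dearer branch, so that the bound does not depend on the state. The
    value on loops is arbitrary. *)
Fixpoint max_cost (p : prog) : nat :=
  match p with
  | Skip | While _ _ => 1
  | Assign _ e => (expr_cost e).+1
  | Put _ e1 e2 => (expr_cost e1 + expr_cost e2).+1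
  | Seq p1 p2 => (max_cost p1 + max_cost p2)%N
  | If b p1 p2 => (test_cost b + maxn (max_cost p1) (max_cost p2)).+1
  end.

Definition Lt (e1 e2 : expr) : test := Not (Le e2 e1).
Definition Or (b1 b2 : test) : test := Not (And (Not b1) (Not b2)).
Definition For (v : nat) (e : expr) (p : prog) : prog :=
  Seq (Assign v (Cst 0))
      (While (Lt (Var v) e) (Seq p (Assign v (Plus (Var v) (Cst 1))))).
(** A round costs [expr_cost e + max_cost p + 8], the initial assignment and the last, failing test
    [expr_cost e + 6]; with 12, [m.+1] times this covers [m] rounds and the rest. *)
Definition for_cost (e : expr) (p : prog) : nat := (expr_cost e + max_cost p + 12)%N.

Section RunsFor.
Local Open Scope nat_scope.
Variables (R : realType) (n : nat) (U : 'I_n -> arc R).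

Lemma runs_final p st : loop_free p -> runs U p st (max_cost p) (eq (final U p st)).
Proof.
elim: p st => //= [|x e|a e1 e2|p1 IH1 p2 IH2|b p1 IH1 p2 IH2] st.
- by exists 1, st; split=> //; exact: exec_skip.
- by eexists _, _; split; first exact: exec_assign.
- by eexists _, _; split; first exact: exec_put.
- by move=> /andP[/IH1 r1 /IH2 r2]; apply: runs_seq (r1 st) _ => _ <-; exact: r2.
- move=> /andP[/IH1 r1 /IH2 r2]; apply: runs_if.
  by case: ifP => _; [apply: runs_weaken (r1 st) (leq_maxl _ _) _
                     | apply: runs_weaken (r2 st) (leq_maxr _ _) _].
Qed.

Lemma runs_for (Inv : nat -> state -> Prop) v e p m st : loop_free p ->
  (forall k st, Inv k st -> var st v = k /\ eval_expr st e = m) ->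
  (forall k st, k < m -> Inv k st ->
     Inv k.+1 (final U (Seq p (Assign v (Plus (Var v) (Cst 1)))) st)) ->
  Inv 0 (final U (Assign v (Cst 0)) st) ->
  runs U (For v e p) st (m.+1 * for_cost e p) (Inv m).
Proof.
move=> lf Inv_v step I0.
have bound : 2 + (m * (test_cost (Lt (Var v) e) + (max_cost p + 4)).+1 +
    (test_cost (Lt (Var v) e)).+1) <= m.+1 * for_cost e p.
  by rewrite /for_cost mulSn /=; nia.
apply: runs_weaken bound (fun _ => id).
apply: runs_seq (runs_final _ _) _ => // _ <-.
apply: (@runs_while _ _ U Inv) => // [k st' km I|st' I].
  have [vk em] := Inv_v _ _ I; split; first by rewrite /= vk em -ltnNge.
  have := @runs_final (Seq p (Assign v (Plus (Var v) (Cst 1)))) st'.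
  by rewrite /= lf => /(_ isT) /runs_weaken; apply=> // _ <-; exact: step.
by have [vk em] := Inv_v _ _ I; rewrite /= vk em leqnn.
Qed.

End RunsFor.

(** * Comparison of endpoints *)

(* Variables: 0 holds n, 1 holds 2n, 2 a loop counter, 3 the width of the blocks of
   merge sort or the exponent of the greedy map, 4-7 the bounds of the blocks, 8 and 9
   the furthest reaching arc and its reach, 10 a full arc plus one, 11-12 scratch.
   Arrays: 0 output, 1 symbols, 2 merged symbols, 3 ranks, 4 iterate of the greedy map,
   5 its square, 6 tags. *)
Definition is_full (e : expr) : test :=
  Or (Not (LeTurn e)) (And (Not (LtTurn e)) (Or (HasEnd Lo e) (HasEnd Hi e))).

Definition check_full : prog :=
  If (is_full (Var 2)) (Assign 10 (Plus (Var 2) (Cst 1))) Skip.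

Definition find_full : prog := For 2 (Var 0) check_full.

(** Sides are fixed arguments of [CycLe], so telling beginnings (symbols below n) from ends takes
    four cases. The base point is the beginning of arc 0. *)
Definition coord_le (e1 e2 : expr) : test :=
  Or (And (Lt e1 (Var 0))
       (Or (And (Lt e2 (Var 0)) (CycLe Lo (Cst 0) Lo e1 Lo e2))
           (And (Le (Var 0) e2) (CycLe Lo (Cst 0) Lo e1 Hi (Minus e2 (Var 0))))))
     (And (Le (Var 0) e1)
       (Or (And (Lt e2 (Var 0)) (CycLe Lo (Cst 0) Hi (Minus e1 (Var 0)) Lo e2))
           (And (Le (Var 0) e2)
                (CycLe Lo (Cst 0) Hi (Minus e1 (Var 0)) Hi (Minus e2 (Var 0)))))).

Definition cut_le (e1 e2 : expr) : test :=
  And (coord_le e1 e2) (Or (Not (coord_le e2 e1)) (Le (Get 6 e1) (Get 6 e2))).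

Section Symbols.
Local Open Scope nat_scope.
Variables (R : realType) (n' : nat) (U : 'I_n'.+1 -> arc R).
Local Notation n := n'.+1.

(* Symbol [x < n] is the beginning of arc [x], symbol [n + x] its end. *)
Definition sym_side (x : nat) : side := if x < n then Lo else Hi.
Definition sym_arc (x : nat) : 'I_n := inord (if x < n then x else x - n).
Definition base_point : circle R := endpoint Lo (U (inord 0)).
Definition sym_coord (x : nat) : R := coord base_point (endpoint (sym_side x) (U (sym_arc x))).
Definition sym_tag (x : nat) : nat := cut_tag (sym_side x) (U (sym_arc x)).
Definition sym_le (x y : nat) : bool :=
  (sym_coord x <= sym_coord y)%R &&
  (~~ (sym_coord y <= sym_coord x)%R || (sym_tag x <= sym_tag y)).

Lemma sym_le_total : total sym_le.
Proof.
move=> x y; rewrite /sym_le; case: (ltgtP (sym_coord x) (sym_coord y)) => //= _.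
exact: leq_total.
Qed.

Lemma sym_le_trans : transitive sym_le.
Proof.
move=> y x z; rewrite /sym_le => /andP[xy txy] /andP[yz tyz].
rewrite (le_trans xy yz) /=; apply/orP.
have [zx|] := boolP (sym_coord z <= sym_coord x)%R; last by left.
right; move: txy tyz; rewrite (le_trans yz zx) (le_trans zx xy) /=.
exact: leq_trans.
Qed.

Lemma sym_leNgt x y : ~~ sym_le y x = cut_lt base_point (sym_side x) (sym_side y) (U (sym_arc x)) (U (sym_arc y)).
Proof.
rewrite /sym_le /cut_lt -/(sym_coord x) -/(sym_coord y) -/(sym_tag x) -/(sym_tag y).
by case: (ltgtP (sym_coord x) (sym_coord y)) => //= _; rewrite ltnNge.
Qed.

Lemma insub_inord k : k < n -> insub k = Some (inord k : 'I_n).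
Proof. by move=> kn; rewrite insubT; congr Some; apply/val_inj; rewrite /= inordK. Qed.

Lemma inputE st e : eval_expr st e < n -> input U st e = Some (U (inord (eval_expr st e))).
Proof. by rewrite /input => /insub_inord ->. Qed.

Lemma eval_is_full st e : eval_expr st e < n ->
  eval_test U st (is_full e) = full_arc (U (inord (eval_expr st e))).
Proof. by move=> en; rewrite /= !inputE //= /full_arc !(negb_and, negb_or) !negbK. Qed.

Lemma eval_coord_le st e1 e2 : var st 0 = n ->
  eval_expr st e1 < n + n -> eval_expr st e2 < n + n ->
  eval_test U st (coord_le e1 e2) = (sym_coord (eval_expr st e1) <= sym_coord (eval_expr st e2))%R.
Proof.
move=> st0 lt1 lt2; rewrite /sym_coord /sym_side /sym_arc.
have sub x : x < n + n -> n <= x -> x - n < n by lia.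
rewrite /= st0; have [e1n|e1n] := ltnP (eval_expr st e1) n;
  have [e2n|e2n] := ltnP (eval_expr st e2) n; rewrite ?andbF ?andbT ?orbF ?negbK /=.
- by rewrite !inputE.
- by rewrite !inputE //= st0 // sub.
- by rewrite !inputE //= st0 // sub.
- by rewrite !inputE //= st0 // sub.
Qed.

Lemma eval_cut_le st e1 e2 : var st 0 = n ->
  eval_expr st e1 < n + n -> eval_expr st e2 < n + n ->
  (forall x, x < n + n -> arr st 6 x = sym_tag x) ->
  eval_test U st (cut_le e1 e2) = sym_le (eval_expr st e1) (eval_expr st e2).
Proof.
move=> st0 lt1 lt2 tags; rewrite /cut_le /Or.
change (eval_test U st (coord_le e1 e2) && ~~ (~~ ~~ eval_test U st (coord_le e2 e1) &&
  ~~ (arr st 6 (eval_expr st e1) <= arr st 6 (eval_expr st e2))) =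
  sym_le (eval_expr st e1) (eval_expr st e2)).
by rewrite !eval_coord_le // !tags // negb_and !negbK.
Qed.

Lemma runs_find_full :
  runs U find_full (init_state n) (n.+1 * for_cost (Var 0) check_full)
    (fun st => [/\ var st 0 = n, forall x, arr st 0 x = 0 &
      (var st 10 = 0 /\ forall i, ~~ full_arc (U i)) \/
      exists i : 'I_n, var st 10 = i.+1 /\ full_arc (U i)]).
Proof.
pose Inv k st := [/\ var st 2 = k, var st 0 = n, forall x, arr st 0 x = 0 &
      (var st 10 = 0 /\ forall i : 'I_n, i < k -> ~~ full_arc (U i)) \/
      exists i : 'I_n, var st 10 = i.+1 /\ full_arc (U i)].
have := @runs_for R n U Inv 2 (Var 0) check_full n (init_state n) isT.
move=> H; apply: runs_weaken (H _ _ _) (leqnn _) _; rewrite {H}.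
- by move=> k st [v2 v0 _ _]; split.
- move=> k st kn [v2 v0 a0 found].
  rewrite /Inv -[final _ _ _]/(final U (Assign 2 _)
    (if eval_test U st (is_full (Var 2)) then _ else _)) eval_is_full /= v2 //.
  case: ifP => full; rewrite /upd /=; split=> //; rewrite ?v2 ?addn1 //.
    by right; exists (inord k); rewrite inordK // addn1.
  case: found => [[v10 nofull]|[i ?]]; [left | by right; exists i].
  split=> // i; rewrite ltnS leq_eqVlt => /predU1P[E|/nofull //].
  by rewrite -[i]inord_val E full.
- by split=> //; left; split.
- move=> st [v2 v0 a0 found]; split=> //.
  by case: found => [[v10 nofull]|]; [left; split=> // i; apply: nofull | right].
Qed.

(** Array 0 has to stay zero up to the last phase, since the output is read off from its nonzero
    entries. *)
Definition with_symbols (st : state) : Prop :=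
  [/\ var st 0 = n, var st 1 = n + n, forall x, arr st 0 x = 0 &
      forall x, x < n + n -> arr st 6 x = sym_tag x].

End Symbols.

(** * Merge sort *)

Section Merge.
Local Open Scope nat_scope.
Variables (le : rel nat) (f : nat -> nat) (w N : nat).
Hypothesis le_total : total le.
Hypothesis le_trans : transitive le.
Hypothesis w_gt0 : 0 < w.

Definition block_sorted (v M : nat) (g : nat -> nat) : Prop :=
  forall p q, p < q -> q < M -> p %/ v = q %/ v -> le (g p) (g q).

Hypothesis f_sorted : block_sorted w N f.

(* The merge of the blocks [s, ea) and [ea, eb) of [f] into [g] has reached the
   positions [a] and [b] of [f] and [o] of [g]. *)
Record merging (s a b o : nat) (g : nat -> nat) : Prop := Merging {
  merging_dvd : w + w %| s;
  merging_a : s <= a <= minn (s + w) N;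
  merging_b : minn (s + w) N <= b <= minn (s + w + w) N;
  merging_o : a + (b - minn (s + w) N) = o;
  merging_perm : perm_eq (map g (iota 0 o))
    (map f (iota 0 a ++ iota (minn (s + w) N) (b - minn (s + w) N)));
  merging_sorted : block_sorted (w + w) o g;
  merging_cross : forall p q, s <= p < o ->
    (a <= q < minn (s + w) N) || (b <= q < minn (s + w + w) N) -> le (g p) (f q) }.

Lemma merging_start o g : w + w %| o -> o <= N ->
  perm_eq (map g (iota 0 o)) (map f (iota 0 o)) -> block_sorted (w + w) o g ->
  merging o o (minn (o + w) N) o g.
Proof.
move=> dvd_o oN perm_g sorted_g; split=> //; rewrite ?subnn ?addn0 ?cats0 //; try lia.
Qed.

Lemma merging_done s a b o g : merging s a b o g -> o = minn (s + w + w) N ->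
  perm_eq (map g (iota 0 o)) (map f (iota 0 o)) /\ (w + w %| o \/ o = N).
Proof.
case=> dvd_s sa sb abo perm_g _ _ E.
have Ea : a = minn (s + w) N by lia.
have Eb : b = o by lia.
split; last first.
  have [le_N|lt_N] := leqP (s + w + w) N; [left | right; lia].
  by rewrite E (minn_idPl le_N) -addnA dvdn_add.
move: perm_g; rewrite -Ea -(iotaD 0 a) subnKC ?Eb //; lia.
Qed.

Lemma map_upd_iota (g : nat -> nat) o v :
  map (upd g o v) (iota 0 o.+1) = rcons (map g (iota 0 o)) v.
Proof.
rewrite -addn1 iotaD map_cat cats1 /= /upd eqxx; congr rcons.
by apply/eq_in_map => i; rewrite mem_iota => io; case: eqP => //; lia.
Qed.

Lemma div_block s p q : w + w %| s -> p <= q -> s <= q < s + (w + w) ->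
  p %/ (w + w) = q %/ (w + w) -> s <= p.
Proof.
have w2 : 0 < w + w by lia.
move=> /dvdnP[t ->] pq /andP[sq qs] E; rewrite leqNgt -ltn_divLR // E -leqNgt.
by rewrite leq_divRL.
Qed.

Lemma left_block_mono s p q : w + w %| s -> s <= p -> p < q -> q < minn (s + w) N -> le (f p) (f q).
Proof.
move=> /dvdnP[t ->] sp pq qe; apply: f_sorted => //; first by lia.
have divE x : t * (w + w) <= x < t * (w + w) + w -> x %/ w = t + t.
  by move=> xw; apply/eqP; rewrite eqn_leq leq_divRL // -ltnS ltn_divLR //; lia.
by rewrite !divE //; lia.
Qed.

Lemma right_block_mono s p q : w + w %| s -> minn (s + w) N <= p -> p < q -> q < minn (s + w + w) N ->
  le (f p) (f q).
Proof.
move=> /dvdnP[t ->] sp pq qe; apply: f_sorted => //; first by lia.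
have divE x : t * (w + w) + w <= x < t * (w + w) + w + w -> x %/ w = (t + t).+1.
  by move=> xw; apply/eqP; rewrite eqn_leq leq_divRL // -ltnS ltn_divLR //; lia.
by rewrite !divE //; lia.
Qed.

Lemma merging_step_sorted s a b o g v : merging s a b o g -> o < s + (w + w) ->
  (forall p, s <= p < o -> le (g p) v) -> block_sorted (w + w) o.+1 (upd g o v).
Proof.
move=> mg os gv p q pq; rewrite ltnS leq_eqVlt /upd => /predU1P[Eq|qo] Edivision; last first.
  have -> : (q == o) = false by lia.
  have -> : (p == o) = false by lia.
  exact: (merging_sorted mg).
subst q; rewrite eqxx; have -> : (p == o) = false by lia.
apply: gv; apply/andP; split; last by lia.
have := merging_o mg; have := merging_a mg; have := merging_b mg => ? ? ?.
by apply: div_block Edivision => //; [exact: (merging_dvd mg) | lia | lia].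
Qed.

(** If the right block is exhausted nothing is compared, hence the conditional hypothesis. *)
Lemma merging_left s a b o g : merging s a b o g -> a < minn (s + w) N ->
  (b < minn (s + w + w) N -> le (f a) (f b)) -> merging s a.+1 b o.+1 (upd g o (f a)).
Proof.
move=> mg ae fab; have [dvd_s sa sb abo perm_g sorted_g cross] := mg.
split=> //; try lia.
- apply/permP => P; move/permP: perm_g => /(_ P).
  by rewrite map_upd_iota -(addn1 a) iotaD -cats1 !map_cat !count_cat /= add0n; lia.
- apply: (merging_step_sorted mg); first by lia.
  by move=> p sp; apply: cross => //; lia.
- move=> p q sp qab; rewrite /upd; case: eqP => [Ep|po]; last by apply: cross; lia.
  case/orP: qab => /andP[lq qe]; first by apply: (left_block_mono dvd_s) => //; lia.
  have {}fab : le (f a) (f b) by apply: fab; lia.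
  have [->//|qb] := eqVneq q b.
  apply: le_trans fab _; apply: (right_block_mono dvd_s); lia.
Qed.

Lemma merging_right s a b o g : merging s a b o g -> b < minn (s + w + w) N ->
  (a < minn (s + w) N -> le (f b) (f a)) -> merging s a b.+1 o.+1 (upd g o (f b)).
Proof.
move=> mg be fab; have [dvd_s sa sb abo perm_g sorted_g cross] := mg.
split=> //; try lia.
- rewrite subSn; last by lia.
  apply/permP => P; move/permP: perm_g => /(_ P).
  rewrite map_upd_iota -(addn1 (b - _)) iotaD subnKC; last by lia.
  by rewrite -cats1 !map_cat !count_cat /=; lia.
- apply: (merging_step_sorted mg); first by lia.
  by move=> p sp; apply: cross => //; lia.
- move=> p q sp qab; rewrite /upd; case: eqP => [Ep|po]; last by apply: cross; lia.
  case/orP: qab => /andP[lq qe]; last by apply: (right_block_mono dvd_s) => //; lia.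
  have {}fab : le (f b) (f a) by apply: fab; lia.
  have [->//|qa] := eqVneq q a.
  apply: le_trans fab _; apply: (left_block_mono dvd_s); lia.
Qed.

End Merge.

(** With truncated subtraction, a - (a - b) is the minimum of a and b. *)
Definition emin (e1 e2 : expr) : expr := Minus e1 (Minus e1 e2).

Definition new_block : prog :=
  Seq (Assign 4 (Var 2))
  (Seq (Assign 5 (emin (Plus (Var 2) (Var 3)) (Var 1)))
  (Seq (Assign 6 (Var 5)) (Assign 7 (emin (Plus (Var 5) (Var 3)) (Var 1))))).

Definition left_first : test :=
  And (Lt (Var 4) (Var 5)) (Or (Le (Var 7) (Var 6)) (cut_le (Get 1 (Var 4)) (Get 1 (Var 6)))).

Definition merge_one : prog :=
  If left_first
    (Seq (Put 2 (Var 2) (Get 1 (Var 4))) (Assign 4 (Plus (Var 4) (Cst 1))))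
    (Seq (Put 2 (Var 2) (Get 1 (Var 6))) (Assign 6 (Plus (Var 6) (Cst 1)))).

(** The loop over output positions also opens the next pair of blocks when the current one is used
    up, so a pass needs no nested loop and its body is loop-free. *)
Definition merge_step : prog := Seq (If (Le (Var 7) (Var 2)) new_block Skip) merge_one.

Definition copy_back : prog := Put 1 (Var 2) (Get 2 (Var 2)).

(** The bound 0 in variable 7 makes the first step open a pair of blocks. *)
Definition merge_pass : prog :=
  Seq (Assign 7 (Cst 0)) (Seq (For 2 (Var 1) merge_step) (For 2 (Var 1) copy_back)).

Definition merge_sort : prog :=
  Seq (Assign 3 (Cst 1))
      (While (Lt (Var 3) (Var 1)) (Seq merge_pass (Assign 3 (Plus (Var 3) (Var 3))))).

Section MergeSort.
Local Open Scope nat_scope.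
Variables (R : realType) (n' : nat) (U : 'I_n'.+1 -> arc R).
Local Notation n := n'.+1.
Let N := n + n.
Local Notation le := (sym_le U).

Section Pass.
Variables (w : nat) (f : nat -> nat).
Hypothesis w_gt0 : 0 < w.
Hypothesis fN : forall p, p < N -> f p < N.
Hypothesis f_sorted : block_sorted le w N f.

Definition pass_state (o : nat) (st : state) : Prop :=
  [/\ var st 2 = o, var st 3 = w, arr st 1 = f & with_symbols U st].

Definition in_block (o s : nat) (st : state) : Prop :=
  [/\ pass_state o st, merging le f w N s (var st 4) (var st 6) o (arr st 2),
      var st 5 = minn (s + w) N, var st 7 = minn (s + w + w) N & o < var st 7].

(** A merged block is complete and the next pair is not yet opened; [var st 7 = o] is what triggers
    the opening. *)
Definition between_blocks (o : nat) (st : state) : Prop :=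
  [/\ pass_state o st, var st 7 = o, w + w %| o \/ o = N,
      perm_eq (map (arr st 2) (iota 0 o)) (map f (iota 0 o)) &
      block_sorted le (w + w) o (arr st 2)].

Lemma after_merge_one o s st : pass_state o.+1 st ->
  merging le f w N s (var st 4) (var st 6) o.+1 (arr st 2) ->
  var st 5 = minn (s + w) N -> var st 7 = minn (s + w + w) N -> o < var st 7 ->
  between_blocks o.+1 st \/ exists s, in_block o.+1 s st.
Proof.
move=> ps mg v5 v7 o7; have [lt7 | ge7] := ltnP o.+1 (var st 7); first by right; exists s.
have E : o.+1 = minn (s + w + w) N by lia.
have [perm_o dvd_o] := merging_done w_gt0 mg E.
left; split=> //; first by rewrite E.
exact: (merging_sorted mg).
Qed.

Lemma merge_oneP o s st : in_block o s st ->
  let st' := final U (Seq merge_one (Assign 2 (Plus (Var 2) (Cst 1)))) st in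
  between_blocks o.+1 st' \/ exists s, in_block o.+1 s st'.
Proof.
move=> [[v2 v3 a1 ws] mg v5 v7 o7] st'; rewrite {}/st'.
have [v0 v1 a0 a6] := ws.
have [_ sa sb abo _ _ _] := mg.
have -> : final U (Seq merge_one (Assign 2 (Plus (Var 2) (Cst 1)))) st =
  final U (Assign 2 (Plus (Var 2) (Cst 1))) (if eval_test U st left_first then
    final U (Seq (Put 2 (Var 2) (Get 1 (Var 4))) (Assign 4 (Plus (Var 4) (Cst 1)))) st else
    final U (Seq (Put 2 (Var 2) (Get 1 (Var 6))) (Assign 6 (Plus (Var 6) (Cst 1)))) st).
  by rewrite /=; case: ifP.
have [left_lt|left_ge] := ltnP (var st 4) (minn (s + w) N); last first.
  have -> : eval_test U st left_first = false by rewrite /= v5 left_ge.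
  apply: (@after_merge_one _ s); rewrite /= /upd /= ?v2 ?addn1 ?a1 //.
  by apply: (merging_right (@sym_le_trans _ _ U) w_gt0 f_sorted mg); lia.
have [right_lt|right_ge] := ltnP (var st 6) (minn (s + w + w) N); last first.
  have -> : eval_test U st left_first by rewrite /= v5 v7 -ltnNge left_lt right_ge.
  apply: (@after_merge_one _ s); rewrite /= /upd /= ?v2 ?addn1 ?a1 //.
  by apply: (merging_left (@sym_le_trans _ _ U) w_gt0 f_sorted mg); lia.
have cmp : eval_test U st (cut_le (Get 1 (Var 4)) (Get 1 (Var 6))) =
    le (f (var st 4)) (f (var st 6)).
  by rewrite eval_cut_le //= ?a1 //; apply: fN; lia.
have -> : eval_test U st left_first = le (f (var st 4)) (f (var st 6)).
  have eval_left c : eval_test U st (And (Lt (Var 4) (Var 5)) (Or (Le (Var 7) (Var 6)) c)) =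
      ~~ (var st 5 <= var st 4) && ~~ (~~ (var st 7 <= var st 6) && ~~ eval_test U st c) by [].
  by rewrite /left_first eval_left cmp v5 v7 -!ltnNge left_lt right_lt negbK.
case: ifP => le46; apply: (@after_merge_one _ s); rewrite /= /upd /= ?v2 ?addn1 ?a1 //.
  by apply: (merging_left (@sym_le_trans _ _ U) w_gt0 f_sorted mg).
apply: (merging_right (@sym_le_trans _ _ U) w_gt0 f_sorted mg) => //.
by move=> _; have := sym_le_total U (f (var st 4)) (f (var st 6)); rewrite le46.
Qed.

Lemma final_guard c p q r st :
  final U (Seq (Seq (If c p Skip) q) r) st =
  final U (Seq q r) (if eval_test U st c then final U p st else st).
Proof. by []. Qed.

Lemma runs_merge_pass st : var st 3 = w -> arr st 1 = f -> with_symbols U st ->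
  runs U merge_pass st (2 + N.+1 * for_cost (Var 1) merge_step + N.+1 * for_cost (Var 1) copy_back)
  (fun st' => [/\ var st' 3 = w, with_symbols U st', block_sorted le (w + w) N (arr st' 1) &
     perm_eq (map (arr st' 1) (iota 0 N)) (map f (iota 0 N))]).
Proof.
move=> v3 a1 ws; rewrite -addnA; apply: runs_seq (runs_final _ _ _) _ => // _ <-.
have [v0 v1 a0 a6] := ws.
pose Inv o st := between_blocks o st \/ exists s, in_block o s st.
apply: runs_seq.
  apply: (@runs_for _ _ U Inv _ _ _ N) => //.
  - by move=> k st' [[[v2' _ _ [_ v1' _ _]]]|[s [[v2' _ _ [_ v1' _ _]]]]].
  - move=> o st1 oN [bt|[s ib]]; last first.
      have o7 : eval_test U st1 (Le (Var 7) (Var 2)) = false.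
        rewrite /=.
        by case: ib => -[-> _ _ _] _ _ _ lt7; rewrite leqNgt lt7.
      have := merge_oneP ib; rewrite /Inv.
      by rewrite /merge_step final_guard o7.
    have [[v2' v3' a1' ws'] v7' dvd_o perm_o sorted_o] := bt.
    have [v0' v1' a0' a6'] := ws'.
    have o7_ : eval_test U st1 (Le (Var 7) (Var 2)) by rewrite /= v2' v7'.
    rewrite /Inv /merge_step final_guard o7_.
    apply: (@merge_oneP o o (final U new_block st1)).
    have minE a b : a - (a - b) = minn a b by lia.
    split; rewrite /= /upd /= ?v1' ?v2' ?v3' ?minE //; try lia.
      apply: merging_start => //; [|exact: ltnW].
      by case: dvd_o => // oN'; move: oN; rewrite oN' ltnn.
  - left; split=> //=; by [left | move=> p q].
move=> st1 [|[s [_ mg _ -> ltN]]]; last first.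
  by lia.
move=> [[v2' v3' a1' ws'] v7' _ perm_o sorted_o].
pose Inv2 k st2 := [/\ var st2 2 = k, var st2 3 = w, with_symbols U st2, arr st2 2 = arr st1 2 &
  forall p, p < k -> arr st2 1 p = arr st1 2 p].
have [v0' v1' a0' a6'] := ws'.
apply: runs_weaken (@runs_for _ _ U Inv2 _ _ _ N _ _ _ _ _) (leqnn _) _ => //.
- by move=> k st2 [? _ [_ ? _ _] _ _].
- move=> k st2 kN [v2 v3'' [? ? ? ?] a2 a1'']; rewrite /Inv2 /= /upd /= v2 addn1.
  split=> // p; rewrite ltnS leq_eqVlt a2 => /predU1P[->|pk]; first by rewrite eqxx.
  by rewrite a1''//; case: eqP => // E; move: pk; rewrite E ltnn.
- move=> st2 [_ v3'' ws'' _ a12]; split=> //.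
    move=> p q pq qN E; rewrite !a12 //; [exact: sorted_o | exact: ltn_trans qN].
  suff -> : map (arr st2 1) (iota 0 N) = map (arr st1 2) (iota 0 N) by [].
  by apply/eq_in_map => p; rewrite mem_iota => /a12.
Qed.

End Pass.
End MergeSort.

(** * Symbols of the endpoints and their ranks *)

Definition rank_body : prog := Put 3 (Get 1 (Var 2)) (Var 2).

Definition rank_symbols : prog := For 2 (Var 1) rank_body.

Definition init_body : prog :=
  Seq (Put 1 (Var 2) (Var 2))
  (Seq (Put 1 (Plus (Var 0) (Var 2)) (Plus (Var 0) (Var 2)))
  (Seq (If (HasEnd Lo (Var 2)) (Put 6 (Var 2) (Cst 1)) (Put 6 (Var 2) (Cst 3)))
       (If (HasEnd Hi (Var 2)) (Put 6 (Plus (Var 0) (Var 2)) (Cst 2))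
                               (Put 6 (Plus (Var 0) (Var 2)) (Cst 0))))).

Definition init_symbols : prog :=
  Seq (Assign 1 (Plus (Var 0) (Var 0))) (For 2 (Var 0) init_body).

Section Ranks.
Local Open Scope nat_scope.
Variables (R : realType) (n' : nat) (U : 'I_n'.+1 -> arc R).
Local Notation n := n'.+1.
Let N := n + n.
Local Notation le := (sym_le U).

Lemma finalS p q st : final U (Seq p q) st = final U q (final U p st).
Proof. by []. Qed.

Lemma final_tag s e c1 c2 st k : var st 2 = k -> k < n ->
  final U (If (HasEnd s (Var 2)) (Put 6 e (Cst c1)) (Put 6 e (Cst c2))) st =
  final U (Put 6 e (Cst (if has_endpoint s (U (inord k)) then c1 else c2))) st.
Proof. by move=> v2 kn; rewrite /= inputE /= v2 //; case: has_endpoint. Qed.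

Lemma runs_init_symbols st : var st 0 = n -> (forall x, arr st 0 x = 0) ->
  runs U init_symbols st
    (4 + n.+1 * for_cost (Var 0) init_body)
    (fun st' => with_symbols U st' /\ forall x, x < N -> arr st' 1 x = x).
Proof.
move=> v0 a0; apply: runs_seq (runs_final _ _ _) _ => // _ <-.
pose Inv k st := [/\ var st 2 = k, var st 0 = n, var st 1 = N, forall x, arr st 0 x = 0 &
  forall x, x < k \/ n <= x < n + k -> arr st 1 x = x /\ arr st 6 x = sym_tag U x].
apply: runs_weaken (@runs_for _ _ U Inv _ _ _ n _ _ _ _ _) (leqnn _) _ => //.
- by move=> k st' [? ? _ _ _].
- move=> k st' kn [v2 v0' v1 a0' done_k].
  have tagLo : sym_tag U k = if has_endpoint Lo (U (inord k)) then 1 else 3.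
    by rewrite /sym_tag /sym_side /sym_arc kn.
  have tagHi : sym_tag U (n + k) = if has_endpoint Hi (U (inord k)) then 2 else 0.
    by rewrite /sym_tag /sym_side /sym_arc ltnNge leq_addr addKn.
  rewrite /= in tagLo tagHi.
  rewrite /Inv !finalS (@final_tag _ _ _ _ _ k) // (@final_tag _ _ _ _ _ k) // -tagLo -tagHi.
  rewrite /= /upd /= v2 v0' addn1;
  (split=> // x xk; have [->|xk'] := eqVneq x (n + k);
    [by rewrite ?eqxx //; case: eqP => //; lia|]);
  (have [->|xk''] := eqVneq x k; [by [] | by apply: done_k; lia]).
- by split=> //=; [rewrite v0 | move=> x; lia].
- move=> st' [_ v0' v1' a0' done_n].
  by split=> [|x xN]; [split=> // x xN|]; have [] := done_n x; rewrite -/N; lia.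
Qed.

Definition sorted_symbols (st : state) : Prop :=
  [/\ with_symbols U st, perm_eq (map (arr st 1) (iota 0 N)) (iota 0 N) &
      forall p q, p < q -> q < N -> le (arr st 1 p) (arr st 1 q)].

Definition sort_cost : nat :=
  for_cost (Var 1) merge_step + for_cost (Var 1) copy_back + 20.

Lemma runs_merge_sort st : with_symbols U st -> (forall x, x < N -> arr st 1 x = x) ->
  runs U merge_sort st (N.+1 * (up_log 2 N).+1 * sort_cost) sorted_symbols.
Proof.
move=> ws a1; have id_st : map (arr st 1) (iota 0 N) = iota 0 N.
  by rewrite -[RHS]map_id; apply/eq_in_map => x; rewrite mem_iota => /a1.
pose Inv k st := [/\ var st 3 = 2 ^ k, with_symbols U st,
  block_sorted le (2 ^ k) N (arr st 1) & perm_eq (map (arr st 1) (iota 0 N)) (iota 0 N)].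
pose pass_cost := 2 + N.+1 * for_cost (Var 1) merge_step + N.+1 * for_cost (Var 1) copy_back.
apply: (@runs_weaken _ _ _ _ _ (2 + (up_log 2 N * (4 + (pass_cost + 4)).+1 + 5)) _ (Inv (up_log 2 N))).
- apply: runs_seq (runs_final _ _ _) _ => // _ <-.
  apply: (@runs_while _ _ U Inv) => //.
  + move=> k st1 kK [v3 ws1 sorted1 perm1]; have [v0 v1 _ _] := ws1.
    have kN : 2 ^ k < N.
      by rewrite ltnNge; apply: contraL kK => /up_log_min; rewrite -leqNgt; apply.
    split; first by rewrite /= v3 v1 -ltnNge.
    apply: runs_seq.
      apply: (runs_merge_pass _ _ sorted1 v3) => //; first by rewrite expn_gt0.
      move=> p pN; suff : arr st1 1 p \in iota 0 N by rewrite mem_iota.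
      by rewrite -(perm_mem perm1) map_f // mem_iota.
    move=> st2 [v3' ws2 sorted2 perm2]; apply: runs_weaken (runs_final _ _ _) _ _ => // _ <-.
    rewrite /Inv /= /upd /= v3' addnn -muln2 -expnSr.
    split=> //; last exact: perm_trans perm1.
    by move: sorted2; rewrite addnn -muln2 -expnSr.
  + move=> st1 [v3 [_ v1 _ _] _ _]; rewrite /= v3 v1 negbK; exact: up_logP.
  + split=> //; last by rewrite -[arr _ 1]/(arr st 1) id_st.
    by move=> p q pq _; rewrite !divn1 => E; move: pq; rewrite E ltnn.
- rewrite /pass_cost /sort_cost; move: (up_log 2 N) (for_cost _ _) (for_cost _ _) => K c1 c2.
  by clear; nia.
- move=> st1 [_ ws1 sorted1 perm1]; split=> // p q pq qN; apply: sorted1 => //.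
  (* The width is now at least [N], so a single block is the whole array. *)
  have := up_logP N (isT : 1 < 2) => NK.
  by rewrite !divn_small //; apply: leq_trans NK => //; exact: ltn_trans qN.
Qed.

Definition ranked_symbols (src rk : nat -> nat) (st : state) : Prop :=
  [/\ with_symbols U st, arr st 1 = src & arr st 3 = rk].

(** Tied symbols may be ranked in either order, so only strict comparisons are required to carry
    over to ranks. *)
Definition ranking (src rk : nat -> nat) : Prop :=
  [/\ forall p, p < N -> src p < N /\ rk (src p) = p,
      forall x, x < N -> rk x < N /\ src (rk x) = x &
      forall x y, x < N -> y < N -> ~~ le y x -> rk x < rk y].

Lemma runs_rank_symbols st : sorted_symbols st ->
  runs U rank_symbols st (N.+1 * for_cost (Var 1) rank_body)
  (fun st' => exists src rk, ranking src rk /\ ranked_symbols src rk st').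
Proof.
move=> [ws perm_src le_src]; have [v0 v1 a0 a6] := ws; set src := arr st 1.
have src_lt p : p < N -> src p < N.
  move=> pN; suff : src p \in iota 0 N by rewrite mem_iota.
  by rewrite -(perm_mem perm_src) map_f // mem_iota.
have src_inj p q : p < N -> q < N -> src p = src q -> p = q.
  move=> pN qN E; have : uniq (map src (iota 0 N)) by rewrite (perm_uniq perm_src) iota_uniq.
  move=> /(uniqP 0) /(_ p q); rewrite !inE size_map size_iota => /(_ pN qN).
  by rewrite !(nth_map 0) ?size_iota // !nth_iota //; apply.
have src_surj x : x < N -> exists2 p, p < N & src p = x.
  move=> xN; have : x \in map src (iota 0 N) by rewrite (perm_mem perm_src) mem_iota.
  by move=> /mapP[p]; rewrite mem_iota => pN ->; exists p.
pose Inv k st' := [/\ var st' 2 = k, with_symbols U st', arr st' 1 = src &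
  forall p, p < k -> arr st' 3 (src p) = p].
apply: runs_weaken (@runs_for _ _ U Inv _ _ _ N _ _ _ _ _) (leqnn _) _ => //.
- by move=> k st' [? [_ ? _ _] _ _].
- move=> k st' kN [v2 [? ? ? ?] a1 a3]; rewrite /Inv /= /upd /= v2 addn1 a1.
  split=> // p; rewrite ltnS leq_eqVlt => /predU1P[->|pk]; first by rewrite eqxx.
  case: eqP => [/src_inj E|_]; last exact: a3.
  by have := E (ltn_trans pk kN) kN; move: pk; clear; lia.
- move=> st' [_ ws' a1 a3]; exists src, (arr st' 3); split=> //; split.
  + by move=> p pN; split; [exact: src_lt | exact: a3].
  + by move=> x /src_surj[p pN <-]; rewrite a3.
  + move=> _ _ /src_surj[p pN <-] /src_surj[q qN <-]; rewrite !a3 // => nle.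
    rewrite ltnNge leq_eqVlt; apply: contra nle => /predU1P[->|qp]; last exact: le_src.
    by have := sym_le_total U (src p) (src p); rewrite orbb.
Qed.

End Ranks.

(** * Computation of the greedy map *)

Definition scan_symbol : prog :=
  If (Lt (Var 2) (Var 1)) (Assign 11 (Get 1 (Var 2)))
                          (Assign 11 (Get 1 (Minus (Var 2) (Var 1)))).

Definition arc_length : prog :=
  If (Le (Get 3 (Var 11)) (Get 3 (Plus (Var 0) (Var 11))))
     (Assign 12 (Minus (Get 3 (Plus (Var 0) (Var 11))) (Get 3 (Var 11))))
     (Assign 12 (Minus (Plus (Get 3 (Plus (Var 0) (Var 11))) (Var 1)) (Get 3 (Var 11)))).

Definition update_best : prog :=
  If (Lt (Var 9) (Plus (Var 2) (Var 12)))
     (Seq (Assign 9 (Plus (Var 2) (Var 12))) (Assign 8 (Var 11))) Skip.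

Definition scan_body : prog :=
  Seq scan_symbol
    (If (Lt (Var 11) (Var 0)) (Seq arc_length update_best)
        (Put 4 (Minus (Var 11) (Var 0)) (Var 8))).

Definition scan : prog :=
  Seq (Assign 9 (Cst 0)) (For 2 (Plus (Var 1) (Var 1)) scan_body).

Section Scan.
Local Open Scope nat_scope.
Variables (R : realType) (n' : nat) (U : 'I_n'.+1 -> arc R).
Local Notation n := n'.+1.
Let N := n + n.
Variables src rk : nat -> nat.
Hypothesis rkP : ranking U src rk.

Definition rank_lo (i : 'I_n) : nat := rk i.
Definition rank_hi (i : 'I_n) : nat := rk (n + i).

Lemma lo_symbol_lt (i : 'I_n) : i < N.
Proof. by rewrite ltn_addr. Qed.

Lemma hi_symbol_lt (i : 'I_n) : n + i < N.
Proof. by rewrite ltn_add2l. Qed.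

Lemma rank_lo_lt i : rank_lo i < N.
Proof. by have [_ /(_ i (lo_symbol_lt i))[]] := rkP. Qed.

Lemma rank_hi_lt i : rank_hi i < N.
Proof. by have [_ /(_ _ (hi_symbol_lt i))[]] := rkP. Qed.

Lemma rank_inj x y : x < N -> y < N -> rk x = rk y -> x = y.
Proof.
by have [_ srck _] := rkP => /srck[_ {2}<-] /srck[_ {2}<-] ->.
Qed.

Lemma rank_hi_inj : injective rank_hi.
Proof. by move=> i j /rank_inj E; apply/val_inj/(@addnI n)/E; apply: hi_symbol_lt. Qed.

Lemma rank_lo_neq_hi i j : rank_lo i != rank_hi j.
Proof.
apply/eqP => /rank_inj E; have := E (lo_symbol_lt i) (hi_symbol_lt j); have := ltn_ord i.
by move: (nat_of_ord i) (nat_of_ord j) => x y; lia.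
Qed.

Local Notation len j := (cdist N (rank_lo j) (rank_hi j)).

Definition greedy_choice (i k : 'I_n) : Prop :=
  forall j, len j + cdist N (rank_lo k) (rank_hi i) <= len k + cdist N (rank_lo j) (rank_hi i).

Lemma len_gt0 j : 0 < len j.
Proof.
move: (rank_lo_lt j) (rank_hi_lt j) (rank_lo_neq_hi j j).
by move: (rank_lo j) (rank_hi j) => x y; clear; cdist_lia.
Qed.

(* Position [q] of the scan, on its turn [t], is the place of the beginning of
   arc [j]; [len j] further on is the place where this copy of the arc ends. *)
Definition starts_at (q t : nat) (j : 'I_n) : Prop := t < 2 /\ q = rank_lo j + t * N.

(** Only entries written on the second turn are claimed to be greedy: on the first, arcs that begin
    later and wrap past the base point have not been met yet. *)
Definition scanning (q : nat) (st : state) : Prop :=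
  [/\ var st 2 = q, ranked_symbols U src rk st,
      forall q' t j, starts_at q' t j -> q' < q -> q' + len j <= var st 9,
      var st 9 = 0 \/ exists q' t (j : 'I_n),
        [/\ starts_at q' t j, q' < q, var st 8 = j & var st 9 = q' + len j] &
      forall i, N + rank_hi i < q -> exists2 k : 'I_n, arr st 4 i = k & greedy_choice i k].

Lemma scan_symbolP q st : scanning q st -> q < N + N ->
  final U scan_symbol st = State (upd (var st) 11 (src (if q < N then q else q - N))) (arr st).
Proof.
move=> [v2 [[_ v1 _ _] a1 _] _ _ _] qN; rewrite /= v2 v1 -ltnNge a1.
by case: ifP.
Qed.

Lemma arc_lengthP st (j : 'I_n) : ranked_symbols U src rk st -> var st 11 = j ->
  final U arc_length st = State (upd (var st) 12 (len j)) (arr st).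
Proof.
move=> [[v0 v1 _ _] a1 a3] v11; rewrite /= v11 v0 v1 a3 /cdist /rank_lo /rank_hi.
by case: ifP.
Qed.

Lemma update_bestP st : final U update_best st =
  if var st 9 < var st 2 + var st 12 then
    State (upd (upd (var st) 9 (var st 2 + var st 12)) 8 (var st 11)) (arr st) else st.
Proof. by rewrite /= -ltnNge. Qed.

Lemma final_if c p q st :
  final U (If c p q) st = if eval_test U st c then final U p st else final U q st.
Proof. by []. Qed.

Lemma scanning_step q st : q < N + N -> scanning q st ->
  scanning q.+1 (final U (Seq scan_body (Assign 2 (Plus (Var 2) (Cst 1)))) st).
Proof.
move=> qN sc; have [v2 rs seen best out] := sc; have [[v0 v1 a0 a6] a1 a3] := rs.
have [src_rk rk_src _] := rkP.
set p := if q < N then q else q - N.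
have pN : p < N by rewrite /p; case: (ltnP q N) => //; move: qN; clear; lia.
have [xN rkx] := src_rk p pN; set x := src p in xN rkx.
have qE : q = p + (if q < N then 0 else 1) * N by rewrite /p; case: (ltnP q N) => ?; rewrite ?addn0 // mul1n subnK.
have start_eq q' t j : starts_at q' t j -> q' < q.+1 -> q' < q \/ [/\ q' = q & x = j].
  move=> [t2 E]; rewrite ltnS leq_eqVlt => /predU1P[Eq|]; [right | by left].
  split=> //; have lo_p : rank_lo j = p.
    move: E qE; rewrite Eq => ->; have := rank_lo_lt j.
    by case: ifP => _; case: t t2 => [|[|//]] _; rewrite ?mul0n ?mul1n ?addn0; lia.
  by rewrite /x -lo_p; have [_ ->] := rk_src _ (lo_symbol_lt j).
rewrite finalS finalS (scan_symbolP sc qN) -/p -/x.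
set st1 := State _ _.
have rs1 : ranked_symbols U src rk st1 by [].
have test_lo : eval_test U st1 (Lt (Var 11) (Var 0)) = (x < n).
  by rewrite /= /upd /= v0 -ltnNge.
have [x_lt|x_ge] := ltnP x n.
- pose j : 'I_n := Ordinal x_lt.
  rewrite final_if test_lo x_lt finalS.
  rewrite (@arc_lengthP st1 j) // update_bestP.
  have lo_j : rank_lo j = p by [].
  have st_j : starts_at q (if q < N then 0 else 1) j.
    by split; [case: ifP | rewrite lo_j].
  have out' i : N + rank_hi i < q.+1 -> N + rank_hi i < q.
    rewrite ltnS leq_eqVlt => /predU1P[E|//].
    have hi_p : rank_hi i = p.
      by move: (rank_hi_lt i) E; rewrite /p; case: (ltnP q N); lia.
    have [_ srci] := rk_src _ (hi_symbol_lt i); move: (x_lt).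
    by rewrite /x -hi_p /rank_hi srci ltnNge leq_addr.
  case: ifP => reach_lt; rewrite /st1 /= /upd /= v2 in reach_lt; split; rewrite /st1 /= /upd /= ?addn1 ?v2 //.
  + move=> q' t k st_k q'q; have [lt_q|[-> xk]] := start_eq q' t k st_k q'q.
      by apply: leq_trans (seen _ _ _ st_k lt_q) _; apply: ltnW.
    by have -> : k = j by apply: val_inj.
  + by right; exists q, (if q < N then 0 else 1), j.
  + by move=> i /out'; apply: out.
  + move=> q' t k st_k q'q; have [lt_q|[-> xk]] := start_eq q' t k st_k q'q.
      exact: (seen _ _ _ st_k).
    by have -> : k = j; [apply: val_inj | rewrite leqNgt reach_lt].
  + case: best => [|[q' [t [k [? ? ? ?]]]]]; [by left | right].
    by exists q', t, k; split=> //; apply: ltnW.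
  + by move=> i /out'; apply: out.
- have x_n : x - n < n by move: xN x_ge; rewrite /N; lia.
  rewrite final_if test_lo ltnNge x_ge /=.
  have lt_eq q' t j : starts_at q' t j -> q' < q.+1 -> q' < q.
    move=> st_j q'q; have [//|[_ xj]] := start_eq _ _ _ st_j q'q.
    by move: x_ge; rewrite xj leqNgt ltn_ord.
  rewrite /st1 /= /upd /= v0 v2 addn1; split=> //=.
  + by move=> q' t j st_j /(lt_eq _ _ _ st_j); apply: (seen _ _ _ st_j).
  + case: best => [|[q' [t [k [? ? ? ?]]]]]; [by left | right].
    by exists q', t, k; split=> //; apply: ltnW.
  + move=> i; rewrite ltnS leq_eqVlt => /predU1P[Eq|lt_q]; last first.
      case: eqP => [Ei|_]; last exact: out.
      have hi_p : rank_hi i = p.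
        by rewrite /rank_hi Ei subnKC.
      move: (rank_hi_lt i) lt_q qE; rewrite hi_p; case: ifP => _; clear; lia.
    have hi_p : rank_hi i = p.
      by move: (rank_hi_lt i) Eq; rewrite /p; case: (ltnP q N); clear; lia.
    have Ei : i = x - n :> nat.
      have [_ srci] := rk_src _ (hi_symbol_lt i).
      by rewrite /x -hi_p /rank_hi srci addKn.
    rewrite Ei eqxx.
    (* The last copy of [j] to begin before the second passage of the end of [i]; it is on the first
       turn when [j] begins at a higher rank than [i] ends. *)
    have copy j : exists q' t, [/\ starts_at q' t j, q' < q & q' + cdist N (rank_lo j) (rank_hi i) = q].
      move: (rank_lo_lt j) (rank_hi_lt i) (rank_lo_neq_hi j i) Eq => loj hii lohi Eq.
      have [lt_i|ge_i] := ltnP (rank_lo j) (rank_hi i).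
        exists (rank_lo j + 1 * N), 1; split; [by [] | lia |].
        by move: loj hii lohi Eq lt_i; rewrite mul1n; clear; cdist_lia.
      exists (rank_lo j + 0 * N), 0; split; [by [] | lia |].
      by move: loj hii lohi Eq ge_i; rewrite mul0n; clear; cdist_lia.
    case: best => [v9|[q0 [t0 [k [st_k lt_k v8 v9]]]]].
      have [q' [t [st_i lt_i _]]] := copy i; have := seen _ _ _ st_i lt_i.
      by have := len_gt0 i; rewrite v9; lia.
    exists k => // j.
    have [q' [t [st_j lt_j Ej]]] := copy j; have := seen _ _ _ st_j lt_j.
    (* The recorded copy of [k] may be a turn older than its last one, hence only an inequality. *)
    have {}lt_k : q0 + cdist N (rank_lo k) (rank_hi i) <= q.
      case: st_k => t02 E0; move: (rank_lo_lt k) (rank_hi_lt i) (rank_lo_neq_hi k i) Eq lt_k.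
      rewrite E0; case: t0 t02 {E0} => [|[|//]] _; rewrite ?mul0n ?mul1n; clear; cdist_lia.
    by rewrite v9; move: lt_k Ej; clear; lia.
Qed.

Lemma runs_scan st : ranked_symbols U src rk st ->
  runs U scan st (2 + (N + N).+1 * for_cost (Plus (Var 1) (Var 1)) scan_body)
  (fun st' => with_symbols U st' /\
     forall i : 'I_n, exists2 k : 'I_n, arr st' 4 i = k & greedy_choice i k).
Proof.
move=> rs; apply: runs_seq (runs_final _ _ _) _ => // _ <-.
apply: runs_weaken (@runs_for _ _ U scanning _ _ _ (N + N) _ _ _ _ _) (leqnn _) _ => //.
- by move=> k st' [? [[_ /= v1 _ _] _ _] _ _ _]; rewrite /= v1.
- by move=> k st' kN; apply: scanning_step.
- by case: rs => -[? ? ? ?] ? ?; split=> //; left.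
- move=> st' [_ [ws _ _] _ _ out]; split; first exact: ws.
  move=> i; apply: out.
  by rewrite ltn_add2l rank_hi_lt.
Qed.

End Scan.

(** * The algorithm *)

Definition square_map : prog := Put 5 (Var 2) (Get 4 (Get 4 (Var 2))).
Definition copy_map : prog := Put 4 (Var 2) (Get 5 (Var 2)).

(** The square is built in array 5, because in array 4 later entries would be composed with entries
    already squared. *)
Definition doubling : prog :=
  Seq (Assign 3 (Cst 1))
    (While (Lt (Var 3) (Var 0))
      (Seq (For 2 (Var 0) square_map)
      (Seq (For 2 (Var 0) copy_map) (Assign 3 (Plus (Var 3) (Var 3)))))).

Definition mark_image : prog := Put 0 (Get 4 (Var 2)) (Cst 1).
Definition output : prog := For 2 (Var 0) mark_image.

Definition core_program : prog :=
  Seq find_full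
    (If (Le (Cst 1) (Var 10)) (Put 0 (Minus (Var 10) (Cst 1)) (Cst 1))
      (Seq init_symbols
      (Seq merge_sort
      (Seq rank_symbols
      (Seq scan
      (Seq doubling output)))))).

Definition time_unit (n : nat) : nat := ((n + n).+1 * (up_log 2 (n + n)).+1)%N.

(** The scan counts twice because it makes two turns; 60 absorbs the remaining constants, among them
    the 20 of the doubling phase. *)
Definition time_factor : nat :=
  (for_cost (Var 0) check_full + for_cost (Var 0) init_body + sort_cost +
   for_cost (Var 1) rank_body + 2 * for_cost (Plus (Var 1) (Var 1)) scan_body +
   for_cost (Var 0) square_map + for_cost (Var 0) copy_map + for_cost (Var 0) mark_image + 60)%N.

Definition time_bound (n : nat) : nat := (time_unit n * time_factor)%N.

Section Core.
Local Open Scope nat_scope.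
Variables (R : realType) (n' : nat) (U : 'I_n'.+1 -> arc R).
Local Notation n := n'.+1.
Let N := n + n.

Definition doubling_cost : nat := for_cost (Var 0) square_map + for_cost (Var 0) copy_map + 20.

Lemma runs_doubling st (h : 'I_n -> 'I_n) : var st 0 = n -> (forall x, arr st 0 x = 0) ->
  (forall i : 'I_n, arr st 4 i = h i) ->
  runs U doubling st (time_unit n * doubling_cost)
  (fun st' => [/\ var st' 0 = n, forall x, arr st' 0 x = 0 &
     exists2 m, n <= m & forall i : 'I_n, arr st' 4 i = iter m h i]).
Proof.
move=> v0 a0 a4; pose Inv k st := [/\ var st 3 = 2 ^ k, var st 0 = n, forall x, arr st 0 x = 0 &
  forall i : 'I_n, arr st 4 i = iter (2 ^ k) h i].
pose K := up_log 2 n.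
pose body_cost := n.+1 * for_cost (Var 0) square_map + (n.+1 * for_cost (Var 0) copy_map + 4).
apply: (@runs_weaken _ _ _ _ _ (2 + (K * (4 + body_cost).+1 + 5)) _ (Inv K)).
- apply: runs_seq (runs_final _ _ _) _ => // _ <-.
  apply: (@runs_while _ _ U Inv) => //.
  + move=> k st1 kK [v3 v0' a0' a4'].
    have kn : 2 ^ k < n.
      by rewrite ltnNge; apply: contraL kK => /up_log_min; rewrite -leqNgt; apply.
    split; first by rewrite /= v3 v0' -ltnNge.
    pose Inv1 i st2 := [/\ var st2 2 = i, var st2 3 = 2 ^ k, var st2 0 = n,
      (forall x, arr st2 0 x = 0) /\ (forall j : 'I_n, arr st2 4 j = iter (2 ^ k) h j) &
      forall j : 'I_n, j < i -> arr st2 5 j = iter (2 ^ k.+1) h j].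
    pose Inv2 i st2 := [/\ var st2 2 = i, var st2 3 = 2 ^ k, var st2 0 = n,
      (forall x, arr st2 0 x = 0) /\ (forall j : 'I_n, arr st2 5 j = iter (2 ^ k.+1) h j) &
      forall j : 'I_n, j < i -> arr st2 4 j = iter (2 ^ k.+1) h j].
    have double_k j : iter (2 ^ k) h (iter (2 ^ k) h j) = iter (2 ^ k.+1) h j.
      by rewrite -iterD addnn -muln2 -expnSr.
    apply: (@runs_seq _ _ _ _ _ _ _ _ (Inv1 n)).
      apply: (@runs_for _ _ U Inv1) => //.
      * by move=> i st2 [].
      * move=> i st2 i_n [v2 v3' v0'' [a0'' a4''] a5]; rewrite /Inv1 /= /upd /= v2 addn1.
        split=> // j; rewrite ltnS leq_eqVlt => /predU1P[ji|ji].
          by rewrite -ji eqxx !a4'' double_k.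
        by case: eqP => [E|_]; [move: ji; rewrite E ltnn | exact: a5].
    move=> st2 [_ v3' v0'' [a0'' a4''] a5].
    apply: (@runs_seq _ _ _ _ _ _ _ _ (Inv2 n)).
      apply: (@runs_for _ _ U Inv2) => //.
      * by move=> i st3 [].
      * move=> i st3 i_n [v2 v3'' v0''' [a0''' a5'] a4''']; rewrite /Inv2 /= /upd /= v2 addn1.
        split=> // j; rewrite ltnS leq_eqVlt => /predU1P[ji|ji].
          by rewrite -ji eqxx a5'.
        by case: eqP => [E|_]; [move: ji; rewrite E ltnn | exact: a4'''].
      * by split=> //; split=> // j; apply: a5.
    move=> st3 [_ v3'' v0''' [a0''' _] a4''']; apply: runs_weaken (runs_final _ _ _) _ _ => // _ <-.
    rewrite /Inv /= /upd /= v3'' addnn -muln2 -expnSr; split=> // j.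
    exact: a4'''.
  + by move=> st1 [v3 v0' _ _]; rewrite /= v3 v0' negbK; exact: up_logP.
- have KN : K <= up_log 2 N by apply: leq_up_log; rewrite /N; lia.
  rewrite /body_cost /doubling_cost /time_unit -/N; have nN : n <= N by rewrite /N; lia.
  move: (for_cost _ _) (for_cost _ _) KN nN => c1 c2; move: (up_log 2 N) K N (n) => L K' N' m.
  by clear; nia.
- move=> st1 [_ v0' a0' a4']; split=> //; exists (2 ^ K) => //; exact: up_logP.
Qed.

Lemma runs_output st (g : 'I_n -> 'I_n) : var st 0 = n -> (forall x, arr st 0 x = 0) ->
  (forall i : 'I_n, arr st 4 i = g i) ->
  runs U output st (n.+1 * for_cost (Var 0) mark_image)
  (fun st' => forall i : 'I_n, arr st' 0 i != 0 <-> exists j, i = g j).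
Proof.
move=> v0 a0 a4; pose Inv k st' := [/\ var st' 2 = k, var st' 0 = n, 
  forall i : 'I_n, arr st' 4 i = g i &
  forall i : 'I_n, arr st' 0 i != 0 <-> exists2 j : 'I_n, j < k & i = g j].
apply: runs_weaken (@runs_for _ _ U Inv _ _ _ n _ _ _ _ _) (leqnn _) _ => //.
- by move=> k st' [].
- move=> k st' kn [v2 v0' a4' a0']; rewrite /Inv /= /upd /= v2 addn1.
  have -> : arr st' 4 k = g (Ordinal kn) by rewrite -a4'.
  split=> // i; case: (altP (nat_of_ord i =P g (Ordinal kn))) => [E|/eqP ne].
    by split=> [_|//]; exists (Ordinal kn); [rewrite /= ltnSn | apply: val_inj].
  rewrite a0'; split=> -[j jk ij]; exists j => //; first exact: ltnW.
  move: jk; rewrite ltnS leq_eqVlt => /predU1P[jk|//].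
  by case: ne; rewrite ij; congr (val (g _)); apply: val_inj.
- by split=> //= i; rewrite a0; split=> // -[].
- move=> st' [_ _ _ a0'] i; rewrite a0'; split=> [[j _ ->]|[j ->]]; first by exists j.
  by exists j.
Qed.

Definition marked (st : state) : {set 'I_n} := [set i : 'I_n | arr st 0 i != 0]%SET.

(** All that the topological part has to know about the run. *)
Definition core_spec (S : {set 'I_n}) : Prop :=
  (exists2 i, full_arc (U i) & S = [set i]%SET) \/
  (forall i, ~~ full_arc (U i)) /\
  exists src rk (h : 'I_n -> 'I_n) m, [/\ ranking U src rk,
    forall i, greedy_choice rk i (h i), n <= m & S = iter_image h m].

Lemma runs_core : runs U core_program (init_state n) (time_bound n)
  (fun st => core_spec (marked st)).
Proof.
pose c_init := for_cost (Var 0) init_body.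
pose c_rank := for_cost (Var 1) rank_body.
pose c_scan := for_cost (Plus (Var 1) (Var 1)) scan_body.
pose c_out := for_cost (Var 0) mark_image.
pose c_full := for_cost (Var 0) check_full.
pose main_cost := (4 + n.+1 * c_init) + (time_unit n * sort_cost + (N.+1 * c_rank +
  ((2 + (N + N).+1 * c_scan) + (time_unit n * doubling_cost + n.+1 * c_out)))).
apply: (@runs_weaken _ _ _ _ _ (n.+1 * c_full + (test_cost (Le (Cst 1) (Var 10)) + (10 + main_cost)).+1)
  _ (fun st => core_spec (marked st))).
- apply: runs_seq (runs_find_full U) _ => st [v0 a0 full]; apply: runs_if.
  case: full => [[v10 nonfull]|[i [v10 full_i]]]; last first.
    rewrite /= v10; have fin := @runs_final _ _ U (Put 0 (Minus (Var 10) (Cst 1)) (Cst 1)) st isT.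
    apply: runs_weaken fin _ _ => [|_ <-]; first by rewrite /=; lia.
    left; exists i => //; apply/setP => j.
    rewrite finset.in_set1 inE /= /upd /= v10 subn1 /= a0.
    have [->|ji] := eqVneq j i; first by rewrite eqxx.
    by case: (altP (nat_of_ord j =P i)) => [/val_inj E|_ //]; rewrite E eqxx in ji.
  rewrite /= v10; apply: (@runs_weaken _ _ _ _ _ main_cost _ (fun st => core_spec (marked st))); [|by lia|by []].
  apply: runs_seq (runs_init_symbols _ v0 a0) _ => st1 [ws1 a1].
  apply: runs_seq (runs_merge_sort ws1 a1) _ => st2 sorted2.
  apply: runs_seq (runs_rank_symbols sorted2) _ => st3 [src [rk [rkP ranked3]]].
  apply: runs_seq (runs_scan rkP ranked3) _ => st4 [[v0' _ a0' _] greedy].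
  have /choice[h hP] : forall i : 'I_n, exists k : 'I_n, arr st4 4 i = k /\ greedy_choice rk i k.
    by move=> i; have [k ? ?] := greedy i; exists k.
  have a4 (i : 'I_n) : arr st4 4 i = h i by have [] := hP i.
  apply: runs_seq (runs_doubling v0' a0' a4) _ => st5 [v0'' a0'' [m nm a4']].
  apply: runs_weaken (runs_output v0'' a0'' a4') _ _ => // st6 out.
  right; split=> //; exists src, rk, h, m; split=> //; first by move=> i; have [] := hP i.
  apply/setP => i; rewrite inE; apply/idP/mem_iter_image; first by move=> /out.
  by move=> ij; apply/out.
- rewrite /main_cost {main_cost} /time_bound /time_factor /doubling_cost -/c_init -/c_rank -/c_scan -/c_out -/c_full.
  move: sort_cost (for_cost _ square_map) (for_cost _ copy_map) c_init c_rank c_scan c_out c_full.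
  have : N.+1 <= time_unit n by rewrite /time_unit leq_pmulr.
  have : n.+1 <= N by rewrite /N; lia.
  rewrite /=; move: (time_unit n) N => D M; clear; nia.
- by [].
Qed.

End Core.

(** * The asymptotic time bound *)

Section TimeBound.
Variable R : realType.

(** By minimality of [up_log], the power of 2 just below it is less than 2n, which is at most n^2
    once n is at least 2. *)
Lemma up_log_le_ln n : (2 <= n)%N ->
  ((up_log 2 (n + n))%:R - 1) * ln (2 : R) <= 2 * ln (n%:R : R).
Proof.
move=> n2; have := @up_log_gtn 2 (n + n) isT; case: (up_log 2 (n + n)) => [|K] /= lt_n.
  have ln2 : 0 <= ln (2 : R) by apply: ln_ge0; lra.
  have lnn : 0 <= ln (n%:R : R) by apply: ln_ge0; rewrite ler1n; apply: ltnW.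
  by rewrite mulrDl; lra.
have {}lt_n : (2 ^ K <= n ^ 2)%N.
  by apply: leq_trans (ltnW (lt_n _)) _; rewrite ?addnn -?mul2n -?mulnn ?leq_mul2r ?n2 ?orbT //; lia.
have n_gt0 : 0 < (n%:R : R) by rewrite ltr0n; apply: ltnW.
rewrite -natr1 addrK !mulr_natl -!lnXn //.
by rewrite ler_ln ?posrE ?exprn_gt0 // -!natrX ler_nat.
Qed.

Lemma time_bound_bigO :
  (fun n : nat => (time_bound n)%:R : R^o) =O_\oo (fun n : nat => n%:R * ln n%:R : R^o).
Proof.
have ln2 : 0 < ln (2 : R) by apply: ln_gt0; lra.
(* 12 is 3 times 4: 2n + 1 is at most 3n, and (K + 1) ln 2 is at most 4 ln n for K the rounded
   logarithm of 2n. *)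
apply/eqO_exP; exists (12 * time_factor%:R / ln 2).
  by rewrite divr_gt0 // mulr_gt0 // ltr0n.
near=> n.
have n2 : (2 <= n)%N by near: n; exact: nbhs_infty_ge.
have lnn : ln 2 <= ln (n%:R : R) by rewrite ler_ln ?posrE ?ltr0n ?ler_nat //; apply: ltnW.
have n_gt0 : 0 < (n%:R : R) by rewrite ltr0n; apply: ltnW.
have ln_n : 0 <= ln (n%:R : R) by apply: le_trans lnn; exact: ltW.
rewrite (ger0_norm (ler0n _ _)) ger0_norm ?mulr_ge0 ?(ltW n_gt0) //.
rewrite /time_bound /time_unit !natrM -(@natr1 _ (n + n)) natrD -(@natr1 _ (up_log 2 _)).
have := up_log_le_ln n2; have n2R : (2 : R) <= n%:R by rewrite (ler_nat _ 2).
have K0 : (0 : R) <= (up_log 2 (n + n))%:R by [].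
have c0 : (0 : R) <= time_factor%:R by [].
move: (up_log 2 (n + n))%:R (n%:R : R) (ln (n%:R : R)) (ln (2 : R)) time_factor%:R n2R K0 c0 lnn ln2 n_gt0 ln_n.
move=> K x L l c x2 K0 c0 lL l0 x0 L0 Kl.
rewrite -(ler_pM2r l0).
have Kl4 : (K + 1) * l <= 4 * L by lra.
rewrite [leLHS](_ : _ = c * ((x + x + 1) * ((K + 1) * l))); last by ring.
rewrite [leRHS](_ : _ = c * (3 * x * (4 * L))); last by field; exact: lt0r_neq0.
apply: ler_wpM2l => //; apply: ler_pM => //; [lra | | lra].
by rewrite mulr_ge0 //; lra.
Unshelve. all: by end_near. Qed.

End TimeBound.

(** * From the computed set to its nerve *)

Lemma complex_of_core (R : realType) (n' : nat) (U : 'I_n'.+1 -> arc R) (S : {set 'I_n'.+1}) :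
  (forall i, arc_set (U i) !=set0) -> core_spec U S ->
  (exists k, complex_iso (nerve S (fun i => arc_set (U i))) (cyclic_complex #|S| k)) /\
  inclusion_homotopy_equivalence R (nerve S (fun i => arc_set (U i)))
    (nerve [set: 'I_n'.+1]%SET (fun i => arc_set (U i))).
Proof.
move=> U_neq0 [[i full_i ->]|[nonfull [src [rk [h [m [rkP greedy nm ->]]]]]]].
  have Ui x : arc_set (U i) x by apply: full_arcP.
  have [x0 _] := U_neq0 i.
  split; first by exists 0%N; apply: (full_arc_iso x0 Ui).
  exact/deformation_retract_equivalence/(full_arc_retract _ x0 Ui).
pose ranks s (i : 'I_n'.+1) := if s is Lo then rank_lo rk i else rank_hi rk i.
have ranksN s i : (ranks s i < n'.+1 + n'.+1)%N.
  by case: s; [apply: rank_lo_lt rkP _ | apply: rank_hi_lt rkP _].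
have sym_lo (i : 'I_n'.+1) : sym_side n' i = Lo /\ sym_arc n' i = i.
  by rewrite /sym_side /sym_arc ltn_ord inord_val.
have sym_hi (i : 'I_n'.+1) : sym_side n' (n'.+1 + i) = Hi /\ sym_arc n' (n'.+1 + i) = i.
  by rewrite /sym_side /sym_arc ltnNge leq_addr /= addKn inord_val.
have ranks_lt s s' i j : cut_lt (base_point U) s s' (U i) (U j) -> (ranks s i < ranks s' j)%N.
  have [_ _ rk_mono] := rkP.
  have [li ai] := sym_lo i; have [lj aj] := sym_lo j.
  have [hi' bi] := sym_hi i; have [hj bj] := sym_hi j.
  have := lo_symbol_lt i; have := lo_symbol_lt j; have := hi_symbol_lt i; have := hi_symbol_lt j => hiN_j hiN_i loN_j loN_i.
  case: s; case: s' => cut; apply: rk_mono => //.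
  - by rewrite sym_leNgt li lj ai aj.
  - by rewrite sym_leNgt li hj ai bj.
  - by rewrite sym_leNgt hi' lj bi aj.
  - by rewrite sym_leNgt hi' hj bi bj.
have lohi := rank_lo_neq_hi rkP.
have gap (s : {set 'I_n'.+1}) : s != finset.set0 ->
  (exists x, forall i, i \in s -> arc_set (U i) x) <->
  (exists2 p, (p < n'.+1 + n'.+1)%N &
     forall i, i \in s -> covers (n'.+1 + n'.+1) (rank_lo rk) (rank_hi (n':=n') rk) i p).
  move=> s0; split=> [[x]|].
    exact: (@gap_of_point R _ _ U (base_point U) ranks).
  exact: (@point_of_gap R _ _ U (base_point U) ranks).
have lN := rank_lo_lt rkP; have rN := rank_hi_lt rkP; have r_inj := rank_hi_inj rkP.
split.
  apply: (periodic_nerve_iso lN rN r_inj lohi greedy gap) => //.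
    by apply: iter_image_fixed; rewrite card_ord.
  by apply/finset.set0Pn; exists (iter m h ord0); apply/mem_iter_image; exists ord0.
apply/deformation_retract_equivalence.
exact: (iter_greedy_retract R lN rN lohi greedy gap).
Qed.

Theorem theorem9p7 (R : realType) :
  exists (p : prog) (T : nat -> nat),
    (fun n : nat => (T n)%:R : R^o) =O_\oo (fun n : nat => n%:R * ln n%:R : R^o) /\
    forall (n : nat) (U : 'I_n -> arc R),
      (1 <= n)%N ->
      (forall i, arc_set (U i) !=set0) ->
      exists (t : nat) (S : {set 'I_n}),
        [/\ computes_in U p t S,
            (t <= T n)%N,
            exists k : nat,
              complex_iso (nerve S (fun i => arc_set (U i))) (cyclic_complex #|S| k) &
            inclusion_homotopy_equivalence R
              (nerve S (fun i => arc_set (U i)))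
              (nerve [set: 'I_n]%SET (fun i => arc_set (U i)))].
Proof.
exists core_program, time_bound; split; first exact: time_bound_bigO.
case=> [//|n'] U _ U_neq0; have [t [st [ex le_t spec]]] := runs_core U.
have [iso incl] := complex_of_core U_neq0 spec.
by exists t, (marked n' st); split=> //; exists st.
Qed.
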